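(* Let $1\le p<\infty$. Let $(B,\|\cdot\|)$ and $(Y,|||\cdot|||)$ be Banach spaces which are subspaces of the same vector space, and let $X\subset B$ be a compactly gauged cone in $B$ with gauge $\langle\langle\cdot\rangle\rangle$. Assume that there is no sequence in $B\cap Y$ converging in $Y$ to $0$ and in $B$ to some non-zero vector. Further, assume that $\mathcal{F}\subset L^p(\mathbb{R}^d;X)\cap L^p(\mathbb{R}^d;Y)$ is bounded in $L^p(\mathbb{R}^d;X)$ (i.e., $\sup_{f\in\mathcal{F}}\langle\langle f\rangle\rangle_p<\infty$), $L^p$-equivanishing in $L^p(\mathbb{R}^d;B)$, and $L^p$-equicontinuous in $L^p(\mathbb{R}^d;Y)$. Then $\mathcal{F}$ is totally bounded in $L^p(\mathbb{R}^d;B)$.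
   Context: $\mathbb{R}^d$ carries Lebesgue measure. For a Banach space $Z$, a function $f\colon \mathbb{R}^d \to Z$ is Bochner measurable if it is the almost everywhere limit of a sequence of simple functions (functions taking finitely many values, each on a measurable set of finite measure). $L^p(\mathbb{R}^d;Z)$ is the Bochner space of (classes of) Bochner measurable functions with $\|f\|_{L^p(\mathbb{R}^d;Z)} = \left(\int_{\mathbb{R}^d}\|f(x)\|_Z^p\,dx\right)^{1/p}<\infty$. A subset of a metric space is totally bounded if for every $\varepsilon>0$ it can be covered by finitely many sets of diameter less than $\varepsilon$; it is precompact if every sequence in it has a convergent subsequence (with limit not necessarily in the subset). A cone is a nonempty subset $X$ of a vector space such that $ax\in X$ whenever $a\in[0,\infty)$ and $x\in X$ (not necessarily convex). A gauge on a cone $X$ is a map $\langle\langle\cdot\rangle\rangle\colon X\to[0,\infty)$ such that $\langle\langle ax\rangle\rangle=a\langle\langle x\rangle\rangle$ for $x\in X$, $a\ge 0$, and $\langle\langle x\rangle\rangle>0$ if $x\neq 0$. A compactly gauged cone in a Banach space $B$ is a cone $X\subset B$ with a gauge such that $\{x\in X:\langle\langle x\rangle\rangle\le 1\}$ is precompact in $B$. There is then a constant $C$ with $\|x\|\le C\langle\langle x\rangle\rangle$ for all $x\in X$. $L^p(\mathbb{R}^d;X)$ is the set of all functions $f\colon\mathbb{R}^d\to X$ such that $f$ is Bochner measurable as a function into $B$, the function $x\mapsto\langle\langle f(x)\rangle\rangle$ is measurable, and $\int_{\mathbb{R}^d}\langle\langle f(x)\rangle\rangle^p\,dx<\infty$.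 One writes $\langle\langle f\rangle\rangle_p=\left(\int_{\mathbb{R}^d}\langle\langle f(x)\rangle\rangle^p\,dx\right)^{1/p}$. Intersections such as $B\cap Y$ are taken in the common vector space; no embedding of $B$ in $Y$ is assumed. For a Banach space $Z$, a set $\mathcal{F}\subset L^p(\mathbb{R}^d;Z)$ is $L^p$-equivanishing in $L^p(\mathbb{R}^d;Z)$ if $\int_{\{|x|>r\}}\|f(x)\|_Z^p\,dx\to 0$ as $r\to\infty$, uniformly for $f\in\mathcal{F}$. It is $L^p$-equicontinuous in $L^p(\mathbb{R}^d;Z)$ if $\|\sigma_h f-f\|_{L^p(\mathbb{R}^d;Z)}\to 0$ as $|h|\to 0$, uniformly for $f\in\mathcal{F}$, where $(\sigma_h f)(x)=f(x+h)$. *)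

(* Defs.v *)
From HB Require Import structures.
From mathcomp Require Import all_boot all_order all_algebra.
From mathcomp Require Import all_classical all_reals all_analysis.

Set Implicit Arguments.
Unset Strict Implicit.
Unset Printing Implicit Defensive.

Import Order.TTheory GRing.Theory Num.Theory.
Import numFieldNormedType.Exports.

Local Open Scope classical_set_scope.
Local Open Scope ring_scope.

(* The norm that the library puts on 'rV[R]_d is the sup norm; |x| is the
   Euclidean norm. *)
Definition euclid {R : realType} {d : nat} (x : 'rV[R]_d) : R :=
  Num.sqrt (\sum_(i < d) x 0 i ^+ 2).

(** Lebesgue measure on R^d: the outer measure obtained from countable covers
    by half-open boxes, restricted to its Caratheodory-measurable sets. *)

Definition box {R : realType} {d : nat} (ab : 'rV[R]_d * 'rV[R]_d) :
    set 'rV[R]_d :=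
  [set x | forall i, ab.1 0 i <= x 0 i < ab.2 0 i].

Definition box_volume {R : realType} {d : nat} (ab : 'rV[R]_d * 'rV[R]_d) : R :=
  \prod_(i < d) Num.max 0 (ab.2 0 i - ab.1 0 i).

Definition box_cover {R : realType} {d : nat} (A : set 'rV[R]_d)
    (C : set ('rV[R]_d * 'rV[R]_d)) : Prop :=
  countable C /\ A `<=` \bigcup_(ab in C) box ab.

Definition lebesgue_outer (R : realType) (d : nat) (A : set 'rV[R]_d) : \bar R :=
  ereal_inf [set (\esum_(ab in C) (box_volume ab)%:E)%E | C in box_cover A].

Section lebesgue_outer_measure.
Variables (R : realType) (d : nat).
Local Open Scope ereal_scope.

Lemma box_volume_ge0 (ab : 'rV[R]_d * 'rV[R]_d) : (0 <= box_volume ab)%R.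
Proof. by apply: prodr_ge0 => i _; rewrite le_max lexx. Qed.

Lemma lebesgue_outer_ge0 (A : set 'rV[R]_d) : 0 <= lebesgue_outer A.
Proof.
apply: le_ereal_inf_tmp => _ [C _ <-]; apply: esum_ge0 => ab _.
by rewrite lee_fin box_volume_ge0.
Qed.

Lemma lebesgue_outer0 : lebesgue_outer (@set0 'rV[R]_d) = 0.
Proof.
apply/eqP; rewrite eq_le lebesgue_outer_ge0 andbT.
apply: ereal_inf_lbound; exists set0; last by rewrite esum_set0.
by split; [exact: countable0 | exact: sub0set].
Qed.

Lemma le_lebesgue_outer :
  {homo @lebesgue_outer R d : A B / A `<=` B >-> A <= B}.
Proof.
move=> A B AB; apply: ereal_inf_le_tmp => _ [C [cC BC] <-].
by exists C => //; split => //; exact: subset_trans BC.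
Qed.

Lemma lebesgue_outer_sigma_subadditive :
  sigma_subadditive (@lebesgue_outer R d).
Proof.
move=> A; have [[i ioo]|] := pselect (exists i, lebesgue_outer (A i) = +oo).
  rewrite (eseries_pinfty _ _ ioo) ?leey// => n _.
  by rewrite -ltNye (lt_le_trans _ (lebesgue_outer_ge0 _)).
rewrite -forallNE => Aoo.
apply/lee_addgt0Pr => e e0.
apply: (@le_trans _ _ (\sum_(i <oo)
    (lebesgue_outer (A i) + (e / (2 ^ i.+1)%:R)%:E))); last first.
  by apply: epsilon_trick; [move=> n; exact: lebesgue_outer_ge0 | exact: ltW].
have [C PC] : {C : nat -> set ('rV[R]_d * 'rV[R]_d) & forall n,
    box_cover (A n) (C n) /\ \esum_(ab in C n) (box_volume ab)%:E <=
      lebesgue_outer (A n) + (e / (2 ^ n.+1)%:R)%:E}.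
  apply: (@choice _ _ (fun n D => box_cover (A n) D /\
    \esum_(ab in D) (box_volume ab)%:E <=
      lebesgue_outer (A n) + (e / (2 ^ n.+1)%:R)%:E)) => n.
  have fA : lebesgue_outer (A n) \is a fin_num.
    by rewrite ge0_fin_numE ?lebesgue_outer_ge0// ltey; exact/eqP/Aoo.
  have en : (0 < e / (2 ^ n.+1)%:R)%R by rewrite divr_gt0// ltr0n expn_gt0.
  have [_ [D AD <-] /ltW DA] := lb_ereal_inf_adherent en fA.
  by exists D.
pose V (ab : 'rV[R]_d * 'rV[R]_d) := (box_volume ab)%:E.
have V0 ab : 0 <= V ab by rewrite lee_fin box_volume_ge0.
apply: (@le_trans _ _ (\esum_(ab in \bigcup_n C n) V ab)).
  apply: ereal_inf_lbound; exists (\bigcup_n C n) => //; split.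
    by apply: bigcup_countable => // n _; exact: (PC n).1.1.
  move=> x [n _ /(PC n).1.2[ab Cab xab]].
  by exists ab => //; exists n.
rewrite seqDU_bigcup_eq (esum_bigcupT _ _ (@trivIset_seqDU _ C) V0).
rewrite -nneseries_esumT; last by move=> n; exact: esum_ge0.
apply: lee_nneseries => [n _ _|n _]; first exact: esum_ge0.
apply: le_trans (PC n).2; apply: ge_ereal_sup => _ [X [finX XC] <-].
apply: esum_ge; exists X => //; split => //.
by apply: subset_trans XC _; exact: subset_seqDU.
Qed.

HB.instance Definition _ := isOuterMeasure.Build R 'rV[R]_d
  (@lebesgue_outer R d) lebesgue_outer0 lebesgue_outer_ge0 le_lebesgue_outer
  lebesgue_outer_sigma_subadditive.

End lebesgue_outer_measure.

(* R^d with the sigma-algebra of Lebesgue-measurable sets. *)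
Notation Rd R d := (caratheodory_type (@lebesgue_outer R d)).

Definition lebesgueRd (R : realType) (d : nat) : set (Rd R d) -> \bar R :=
  @lebesgue_outer R d.

HB.instance Definition _ (R : realType) (d : nat) :=
  isMeasure.Build _ (Rd R d) R (@lebesgueRd R d)
    (@caratheodory_measure0 R 'rV[R]_d (@lebesgue_outer R d))
    (@caratheodory_measure_ge0 R 'rV[R]_d (@lebesgue_outer R d))
    (@caratheodory_measure_sigma_additive R 'rV[R]_d (@lebesgue_outer R d)).

(** Bochner spaces. Their elements are represented by functions; functions
    that are equal almost everywhere are at distance 0. *)

(* The value 0 may be taken on a set of infinite measure. *)
Definition simple_function {R : realType} {d : nat} {Z : normedModType R}
    (s : Rd R d -> Z) : Prop :=
  finite_set (range s) /\
  forall z, measurable (s @^-1` [set z]) /\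
    (z != 0 -> (lebesgueRd (s @^-1` [set z]) < +oo)%E).

Definition bochner_measurable {R : realType} {d : nat} {Z : normedModType R}
    (f : Rd R d -> Z) : Prop :=
  exists2 s : nat -> Rd R d -> Z, (forall n, simple_function (s n)) &
    {ae @lebesgueRd R d, forall x, (s n x) @[n --> \oo] --> f x}.

Definition Lp_norm {R : realType} {d : nat} {Z : normedModType R} (p : R)
    (f : Rd R d -> Z) : \bar R :=
  Lnorm (@lebesgueRd R d) p%:E (fun x => `|f x|%:E).

Definition Lp {R : realType} {d : nat} (Z : normedModType R) (p : R) :
    set (Rd R d -> Z) :=
  [set f | bochner_measurable f /\ (Lp_norm p f < +oo)%E].
Arguments Lp {R d} Z p _.

Definition Lp_dist {R : realType} {d : nat} {Z : normedModType R} (p : R)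
    (f g : Rd R d -> Z) : \bar R :=
  Lp_norm p (fun x => f x - g x).

Definition totally_bounded {R : realType} {T : Type} (dist : T -> T -> \bar R)
    (M F : set T) : Prop :=
  forall e : R, 0 < e -> exists (n : nat) (A : 'I_n -> set T),
    (forall i, A i `<=` M /\
      (ereal_sup [set dist fg.1 fg.2 | fg in A i `*` A i] < e%:E)%E) /\
    F `<=` \bigcup_i A i.

Definition Lp_equivanishing {R : realType} {d : nat} {Z : normedModType R}
    (p : R) (F : set (Rd R d -> Z)) : Prop :=
  forall e : R, 0 < e -> exists r0 : R, forall r, r0 <= r -> forall f, F f ->
    (\int[@lebesgueRd R d]_(x in [set x | (r < euclid x)%R])
       (`|f x| `^ p)%:E < e%:E)%E.

Definition translate {R : realType} {d : nat} {Z : Type} (h : 'rV[R]_d)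
    (f : Rd R d -> Z) : Rd R d -> Z :=
  fun x => f ((x : 'rV[R]_d) + h).

Definition Lp_equicontinuous {R : realType} {d : nat} {Z : normedModType R}
    (p : R) (F : set (Rd R d -> Z)) : Prop :=
  forall e : R, 0 < e -> exists2 delta : R, 0 < delta &
    forall h : 'rV[R]_d, euclid h < delta -> forall f, F f ->
      (Lp_dist p (translate h f) f < e%:E)%E.

(** Compactly gauged cones. The gauge is a total function on B, of which only
    the values on X matter. *)

Definition is_cone {R : realType} {V : lmodType R} (X : set V) : Prop :=
  X !=set0 /\ forall (a : R) x, 0 <= a -> X x -> X (a *: x).

Definition is_gauge {R : realType} {V : lmodType R} (X : set V) (g : V -> R) :
    Prop :=
  [/\ forall x, X x -> 0 <= g x,
      forall (a : R) x, 0 <= a -> X x -> g (a *: x) = a * g x &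
      forall x, X x -> x != 0 -> 0 < g x].

(* Sequential; the library's [precompact] is compactness of the closure. *)
Definition seq_precompact {T : topologicalType} (K : set T) : Prop :=
  forall u : nat -> T, (forall n, K (u n)) ->
    exists2 k : nat -> nat, {homo k : m n / (m < n)%N} &
      exists l : T, u (k n) @[n --> \oo] --> l.

Definition compactly_gauged_cone {R : realType} {B : normedModType R}
    (X : set B) (g : B -> R) : Prop :=
  [/\ is_cone X, is_gauge X g & seq_precompact [set x | X x /\ g x <= 1]].

Definition Lp_gauge {R : realType} {d : nat} {B : Type} (g : B -> R) (p : R)
    (f : Rd R d -> B) : \bar R :=
  Lnorm (@lebesgueRd R d) p%:E (fun x => (g (f x))%:E).

Definition Lp_cone {R : realType} {d : nat} {B : normedModType R} (X : set B)
    (g : B -> R) (p : R) : set (Rd R d -> B) :=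
  [set f | [/\ forall x, X (f x), bochner_measurable f,
               measurable_fun setT (g \o f) &
               (\int[@lebesgueRd R d]_x (g (f x) `^ p)%:E < +oo)%E]].

(** Banach spaces B and Y that are subspaces of one vector space V are given by
    injective linear maps iB : B -> V and iY : Y -> V. *)

(* The elements of L^p(R^d; Y) that are also in F: as L^p(R^d; Y) consists of
   classes, f and g are identified when they agree in V almost everywhere. *)
Definition Lp_representatives {R : realType} {d : nat} {V : lmodType R}
    {B Y : normedModType R} (iB : B -> V) (iY : Y -> V) (p : R)
    (F : set (Rd R d -> B)) : set (Rd R d -> Y) :=
  [set g | Lp Y p g /\
    exists2 f, F f & {ae @lebesgueRd R d, forall x, iY (g x) = iB (f x)}].

Definition no_separating_sequence {R : realType} {V : lmodType R}
    {B Y : normedModType R} (iB : B -> V) (iY : Y -> V) : Prop :=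
  ~ exists (b : nat -> B) (y : nat -> Y) (l : B),
    [/\ forall n, iB (b n) = iY (y n),
        y n @[n --> \oo] --> (0 : Y),
        b n @[n --> \oo] --> l & l != 0].

(* Main.v *)
From HB Require Import structures.
Require Import Defs.
From mathcomp Require Import all_boot all_order all_algebra.
From mathcomp Require Import all_classical all_reals all_analysis.
From mathcomp Require Import measurable_realfun ring lra.
Import Order.TTheory GRing.Theory Num.Theory.
Import numFieldNormedType.Exports.
Local Open Scope classical_set_scope.
Local Open Scope ring_scope.

Set Implicit Arguments.
Unset Strict Implicit.
Unset Printing Implicit Defensive.

(** Two ideas carry the proof: the gauge turns equicontinuity in Y into
    equicontinuity in B, and the Riesz-Kolmogorov argument is run with sampled
    values in place of averages, since an average of values of f may leave a
    cone X that is not convex, and nothing is then known about its gauge.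

    Equicontinuity in B ([gauge_equicontinuous]).  Compactness of the unit
    gauge ball and the absence of a separating sequence give, as in Ehrling's
    lemma, for each e a constant C with
      |x - y|_B <= e (<<x>> + <<y>>) + C |x - y|_Y   for all x, y in X
    ([gauge_interpolation]).  Apply this to x = f(t + h), y = f(t), take p-th
    powers and integrate: the first term is small with e, uniformly on F, by
    the bound on the gauges, and the second one is small with h.

    Sampling ([sampling], [cone_sampling]).  Cut a large cube into tiles of
    side r.  Tonelli's theorem and translation invariance give
      int (int_{[-r,r)^d} |f(x + h) - f(x)|^p dh) dx <= |[-r,r)^d| w
    when w bounds int |f(x + h) - f(x)|^p dx for h in [-r,r)^d.  Hence each
    tile E contains a point y at which the inner integral, and also
    <<f(y)>>^p, do not exceed their averages over E.  As E - y lies in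
    [-r,r)^d, the inner integral at y bounds int_E |f - f(y)|^p.  The measure
    |[-r,r)^d| is at most 2^d |E|, so dividing by |E| leaves a bound on the
    total error that does not depend on r.

    Total boundedness ([cone_totally_bounded]).  The sampled values lie in one
    gauge ball {<<x>> <= L}, which has a finite net.  Rounding the value on
    each tile to a point of the net leaves finitely many step functions; every
    f in F is L^p-close to one of them on the large cube, and F is uniformly
    small outside of it.

    Tonelli's theorem needs (x, h) |-> f(x + h) to be measurable for the
    product sigma-algebra.  This fails for a general Lebesgue measurable f, so
    f is first changed on a null set into a pointwise limit of Borel simple
    functions ([bochner_borel_limit]). *)

(** * Lebesgue measure: translations and half-spaces *)

Section lebesgue_measure_Rd.
Context {R : realType}.

(** Transported covers are images of covers under maps that may identify
    boxes, so the injectivity asked for by [esum_image] has to be avoided. *)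
Lemma esum_image_le (T T' : choiceType) (P : set T) (e : T -> T')
    (a : T' -> \bar R) : (forall t, 0 <= a t)%E ->
  (\esum_(j in e @` P) a j <= \esum_(i in P) a (e i))%E.
Proof.
move=> a0; have [->|/set0P[i0 Pi0]] := eqVneq P set0.
  by rewrite image_set0 !esum_set0.
have [g gP] : {g : T' -> T & forall j, (e @` P) j -> P (g j) /\ e (g j) = j}.
  apply: (@choice _ _ (fun j i => (e @` P) j -> P i /\ e i = j)) => j.
  have [[i Pi <-]|nj] := pselect ((e @` P) j); first by exists i.
  by exists i0 => /nj.
rewrite (eq_esum (fun j Pj => congr1 a (esym (gP j Pj).2))).
rewrite -(esum_image _ g (fun i => a (e i))); last first.
  move=> j k; rewrite !inE => /gP[_ ej] /gP[_ ek] jk.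
  by rewrite -ej -ek jk.
rewrite esum_mkcond [leRHS]esum_mkcond; apply: le_esum => i _.
case: ifPn => // [|_]; last by case: ifP.
by rewrite inE => -[j /gP[Pg _] <-]; rewrite mem_set.
Qed.

Context {d : nat}.
Local Notation mu := (@lebesgueRd R d).
Implicit Types (x h : 'rV[R]_d) (ab : 'rV[R]_d * 'rV[R]_d).

Let vol_ge0 ab : (0 <= (box_volume ab)%:E)%E.
Proof. by rewrite lee_fin box_volume_ge0. Qed.

Definition translation h : Rd R d -> Rd R d := fun x => (x : 'rV[R]_d) + h.

Lemma le_outer_translate h (A : set 'rV[R]_d) :
  (lebesgue_outer [set (x + h)%R | x in A] <= lebesgue_outer A)%E.
Proof.
apply: le_ereal_inf_tmp => _ [C [cC AC] <-].
pose s ab := ((ab.1 + h)%R, (ab.2 + h)%R).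
apply: (@le_trans _ _ (\esum_(ab in s @` C) (box_volume ab)%:E)%E).
  apply: ereal_inf_lbound; exists (s @` C) => //; split.
    exact: sub_countable (card_image_le _ _) cC.
  move=> _ [x /AC [ab Cab abx] <-]; exists (s ab); first by exists ab.
  by move=> i; have := abx i; rewrite /s /= !mxE !lerD2r !ltrD2r.
apply: le_trans (esum_image_le _ _ vol_ge0) _.
apply: le_esum => ab _; rewrite lee_fin /box_volume /s /=.
rewrite le_eqVlt; apply/orP; left; apply/eqP/eq_bigr => i _.
by rewrite !mxE opprD addrACA subrr addr0.
Qed.

Lemma outer_preimage_translate h (A : set 'rV[R]_d) :
  lebesgue_outer ((fun x => x + h) @^-1` A) = lebesgue_outer A.
Proof.
have preimageE k (D : set 'rV[R]_d) :
    (fun x => x + k) @^-1` D = [set x + (- k) | x in D].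
  apply/seteqP; split => [x Dx|_ [x Dx <-]]; last by rewrite /preimage/= subrK.
  by exists (x + k) => //; rewrite addrK.
apply/eqP; rewrite eq_le preimageE le_outer_translate /=.
rewrite -[X in (lebesgue_outer X <= _)%E](_ :
    [set x + h | x in [set x - h | x in A]] = A).
  exact: le_outer_translate.
apply/seteqP; split => [_ [_ [x Ax <-] <-]|x Ax]; first by rewrite subrK.
by exists (x - h); [exists x|rewrite subrK].
Qed.

Lemma measurable_translate h :
  measurable_fun setT (translation h).
Proof.
move=> _ A /= mA; rewrite setTI.
have {}mA : caratheodory_measurable (@lebesgue_outer R d) A by [].
suff : caratheodory_measurable (@lebesgue_outer R d) ((fun x => x + h) @^-1` A) by [].
move=> D.
have e : D = (fun x => x + h) @^-1` ((fun x => x - h) @^-1` D).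
  by apply/seteqP; split => x /=; rewrite addrK.
rewrite e -preimage_setI preimage_setC -preimage_setI.
rewrite !outer_preimage_translate -[LHS](outer_preimage_translate (- h)).
exact: mA.
Qed.

Lemma measurable_translate_preimage h (A : set (Rd R d)) : measurable A ->
  measurable ((translation h) @^-1` A).
Proof. by move=> mA; rewrite -[X in measurable X]setTI; exact: measurable_translate. Qed.

Lemma ge0_integral_translate h (D : set (Rd R d)) (f : Rd R d -> \bar R) :
  measurable D -> measurable_fun D f -> (forall x, D x -> (0 <= f x)%E) ->
  (\int[mu]_(x in (translation h) @^-1` D)
     f (translation h x) = \int[mu]_(x in D) f x)%E.
Proof.
move=> mD mf f0.
rewrite -(ge0_integral_pushforward (measurable_translate h) mu mD mf); last first.
  by move=> x; rewrite inE; exact: f0.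
apply: eq_measure_integral; first exact: measurable_translate.
move=> mt A mA _; exact: outer_preimage_translate.
Qed.

Lemma ae_translate h (P : 'rV[R]_d -> Prop) :
  {ae mu, forall x, P x} -> {ae mu, forall x, P (x + h)}.
Proof.
move=> [N [mN N0 PN]]; exists ((translation h) @^-1` N).
split; first exact: measurable_translate_preimage.
- by rewrite -N0; exact: outer_preimage_translate.
- by move=> x nP; exact: PN.
Qed.

Definition cut_below (i : 'I_d) (c : R) ab : 'rV[R]_d * 'rV[R]_d :=
  (ab.1, \row_j if j == i then Num.min (ab.2 0 j) c else ab.2 0 j).

Definition cut_above (i : 'I_d) (c : R) ab : 'rV[R]_d * 'rV[R]_d :=
  (\row_j if j == i then Num.max (ab.1 0 j) c else ab.1 0 j, ab.2).

Lemma box_volume_cut (i : 'I_d) (c : R) ab :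
  box_volume (cut_below i c ab) + box_volume (cut_above i c ab) = box_volume ab.
Proof.
rewrite /box_volume (bigD1 i)//= [X in _ + X](bigD1 i)//= [RHS](bigD1 i)//=.
set P := (X in _ * X + _); set Q := (X in _ + _ * X); set S := (X in _ = _ * X).
have -> : P = S by apply: eq_bigr => j ji; rewrite !mxE (negbTE ji).
have -> : Q = S by apply: eq_bigr => j ji; rewrite !mxE (negbTE ji).
rewrite -mulrDl; congr (_ * _); rewrite !mxE eqxx.
rewrite /Num.max /Num.min; repeat case: ifPn; rewrite -?leNgt; lra.
Qed.

(** Cutting every box of a cover along the hyperplane x_i = c yields covers of
    both parts of the set, with the same total volume: this is Caratheodory's
    criterion. *)
Lemma measurable_halfspace (i : 'I_d) (c : R) :
  measurable ([set x | x 0 i < c] : set (Rd R d)).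
Proof.
apply: le_caratheodory_measurable => A.
apply: le_ereal_inf_tmp => _ [C [cC AC] <-].
pose lo := cut_below i c; pose up := cut_above i c.
rewrite (eq_esum (fun ab _ => esym (congr1 EFin (box_volume_cut i c ab)))).
under eq_esum do rewrite EFinD.
rewrite esumD//; apply: leeD.
- apply: le_trans (esum_image_le C lo vol_ge0).
  apply: ereal_inf_lbound; exists (lo @` C) => //; split.
    exact: sub_countable (card_image_le _ _) cC.
  move=> x [/AC [ab Cab abx] /= xc]; exists (lo ab); first by exists ab.
  move=> j; rewrite /lo /cut_below/= mxE; have /andP[-> xb] := abx j.
  by case: eqP => [ji|//]; rewrite lt_min xb ji xc.
- apply: le_trans (esum_image_le C up vol_ge0).
  apply: ereal_inf_lbound; exists (up @` C) => //; split.
    exact: sub_countable (card_image_le _ _) cC.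
  move=> x [/AC [ab Cab abx] /= /negP/negbTE xc]; exists (up ab); first by exists ab.
  move=> j; rewrite /up /cut_above/= mxE; have /andP[ax ->] := abx j.
  by rewrite andbT; case: eqP => [ji|//]; rewrite ge_max ax ji leNgt xc.
Qed.

Lemma measurable_coord (i : 'I_d) :
  measurable_fun setT ((fun x => x 0 i) : Rd R d -> R).
Proof.
apply: (measurability _ (RGenInftyO.measurableE R)) => _ [_ [c ->] <-].
by rewrite setTI; exact: (measurable_halfspace i c).
Qed.

End lebesgue_measure_Rd.

(** * Borel sets, hulls and tiles *)

Section boxes.
Context {R : realType} {d : nat}.
Local Notation mu := (@lebesgueRd R d).
Implicit Types (r : R) (x h : 'rV[R]_d) (ab : 'rV[R]_d * 'rV[R]_d).

(** The sigma-algebra generated by boxes.  It is needed alongside that of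
    Caratheodory because only Borel sets pull back along addition to the
    product sigma-algebra ([borel_addition]). *)
Definition borel (A : set 'rV[R]_d) : Prop := <<s range box >> A.

Lemma borel_countable_box (C : set ('rV[R]_d * 'rV[R]_d)) : countable C ->
  borel (\bigcup_(ab in C) box ab).
Proof.
move=> cC; rewrite bigcup_set_type.
apply: (@countable_bigcupT_measurable _ (g_sigma_algebraType (range (@box R d)))).
  by rewrite (eq_countable (card_setT C)).
by move=> ab; apply: sub_sigma_algebra; exists (val ab).
Qed.

(** The intersection of countable box covers of A whose total volumes tend to
    the outer measure of A. *)
Lemma borel_hull (A : set 'rV[R]_d) : exists A' : set 'rV[R]_d,
  [/\ borel A', A `<=` A' & (lebesgue_outer A' <= lebesgue_outer A)%E].
Proof.
have [Aoo|Afin] := eqVneq (lebesgue_outer A) +oo%E.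
  exists setT; split => //; last by rewrite Aoo leey.
  exact: (@measurableT _ (g_sigma_algebraType (range (@box R d)))).
have fA : lebesgue_outer A \is a fin_num.
  by rewrite ge0_fin_numE ?lebesgue_outer_ge0// ltey.
have [C PC] : {C : nat -> set ('rV[R]_d * 'rV[R]_d) & forall n,
    box_cover A (C n) /\ (\esum_(ab in C n) (box_volume ab)%:E <=
      lebesgue_outer A + (n.+1%:R^-1)%:E)%E}.
  apply: (@choice _ _ (fun n D => box_cover A D /\
    (\esum_(ab in D) (box_volume ab)%:E <=
      lebesgue_outer A + (n.+1%:R^-1)%:E)%E)) => n.
  have [|_ [D AD <-] /ltW DA] := @lb_ereal_inf_adherent _ _ (n.+1%:R^-1) _ fA.
    by rewrite invr_gt0 ltr0n.
  by exists D.
exists (\bigcap_n \bigcup_(ab in C n) box ab); split.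
- apply: (@bigcapT_measurable _ (g_sigma_algebraType (range (@box R d)))) => n.
  exact: borel_countable_box (PC n).1.1.
- by move=> x Ax n _; exact: (PC n).1.2.
- apply/lee_addgt0Pr => e e0.
  have [n ne] : exists n, n.+1%:R^-1 < e.
    by have [n _ /(_ n (leqnn _)) /= ne] := near_infty_natSinv_lt (PosNum e0); exists n.
  apply: (@le_trans _ _ (lebesgue_outer A + (n.+1%:R^-1)%:E)%E); last first.
    by rewrite leeD2lE// lee_fin ltW.
  apply: le_trans (PC n).2; apply: ereal_inf_lbound; exists (C n) => //; split.
    exact: (PC n).1.1.
  by apply: bigcap_inf.
Qed.

Lemma measurable_box ab : measurable (box ab : set (Rd R d)).
Proof.
rewrite (_ : box ab = \bigcap_(i in [set: 'I_d])
    ((fun x => x 0 i) @^-1` `[ab.1 0 i, ab.2 0 i[%classic)); last first.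
  by apply/seteqP; split => x xab i => [_|]; have := xab i; rewrite /= in_itv//; exact.
apply: fin_bigcap_measurable => // i _; rewrite -[X in measurable X]setTI.
exact: measurable_coord.
Qed.

Lemma borel_measurable (A : set 'rV[R]_d) : borel A -> measurable (A : set (Rd R d)).
Proof.
apply: smallest_sub; first exact: sigma_algebra_measurable.
by move=> _ [ab _ <-]; exact: measurable_box.
Qed.

Lemma borel_addition (A : set 'rV[R]_d) : borel A ->
  measurable ((fun z : Rd R d * Rd R d => translation z.2 z.1) @^-1` A).
Proof.
move=> bA; rewrite -[X in measurable X]setTI.
pose f (z : Rd R d * Rd R d) : g_sigma_algebraType (range (@box R d)) :=
  translation z.2 z.1.
suff mf : measurable_fun setT f by exact: mf.
apply: (@measurability _ _ _ _ setT f (range (@box R d))) => // _ [_ [ab _ <-] <-].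
rewrite setTI (_ : f @^-1` _ = \bigcap_(i in [set: 'I_d])
    ((fun z : Rd R d * Rd R d => (z.1 : 'rV[R]_d) 0 i + (z.2 : 'rV[R]_d) 0 i)
      @^-1` `[ab.1 0 i, ab.2 0 i[%classic)); last first.
  by apply/seteqP; split => x xab i => [_|]; have := xab i;
    rewrite /= in_itv/= /f /translation mxE//; exact.
apply: fin_bigcap_measurable => // i _; rewrite -[X in measurable X]setTI.
apply: (@measurable_funD _ _ _ setT (fun z : Rd R d * Rd R d => (z.1 : 'rV[R]_d) 0 i)
  (fun z : Rd R d * Rd R d => (z.2 : 'rV[R]_d) 0 i)) => //.
- exact: (measurableT_comp (measurable_coord i) measurable_fst).
- exact: (measurableT_comp (measurable_coord i) measurable_snd).
Qed.

Lemma borel_measurable_fst (A : set 'rV[R]_d) : borel A ->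
  measurable ((fun z : Rd R d * Rd R d => z.1) @^-1` A).
Proof.
move=> /borel_measurable mA; rewrite -[X in measurable X]setTI.
exact: measurable_fst.
Qed.

Lemma negligible_borel_hull (N : set (Rd R d)) : mu.-negligible N ->
  exists N0 : set 'rV[R]_d, [/\ borel N0, mu N0 = 0%E & N `<=` N0].
Proof.
move=> [M [mM M0 NM]]; have [N0 [bN0 MN0 N0M]] := borel_hull M.
exists N0; split => //; last exact: subset_trans NM MN0.
by apply/eqP; rewrite eq_le measure_ge0 andbT -M0.
Qed.

Lemma lebesgue_complete (N A : set (Rd R d)) : mu N = 0%E -> A `<=` N ->
  measurable A.
Proof.
move=> N0 AN; apply: le_caratheodory_measurable => X.
rewrite [X in (X + _)%E](_ : _ = 0%E) ?add0e; last first.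
  apply/eqP; rewrite eq_le lebesgue_outer_ge0 andbT -N0.
  by apply: le_lebesgue_outer => x [_ /AN].
by apply: le_lebesgue_outer => x [].
Qed.

Lemma lebesgueRd_is_complete : measure_is_complete mu.
Proof. by move=> A [N [_ N0 AN]]; exact: lebesgue_complete N0 AN. Qed.

(** The cube of side r at position c in the grid of (2N)^d cubes that cuts
    [-rN, rN)^d. *)
Definition tile (r : R) (N : nat) (c : {ffun 'I_d -> 'I_(N + N)}) :
    set 'rV[R]_d :=
  [set x | forall i, r * ((c i)%:R - N%:R) <= x 0 i < r * ((c i).+1%:R - N%:R)].

(** Of side 2r: it contains the differences of two points of one tile
    ([tile_sub_cube]). *)
Definition cube (r : R) : set 'rV[R]_d := [set x | forall i, - r <= x 0 i < r].

Lemma tileE r N c : @tile r N c =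
  box (\row_i (r * ((c i)%:R - N%:R)), \row_i (r * ((c i).+1%:R - N%:R))).
Proof. by apply/seteqP; split => x xc i; have := xc i; rewrite /= !mxE. Qed.

Lemma cubeE r : cube r = box (const_mx (- r), const_mx r).
Proof. by apply/seteqP; split => x xc i; have := xc i; rewrite /= !mxE. Qed.

Lemma measurable_tile r N c : measurable (@tile r N c : set (Rd R d)).
Proof. by rewrite tileE; exact: measurable_box. Qed.

Lemma measurable_cube r : measurable (cube r : set (Rd R d)).
Proof. by rewrite cubeE; exact: measurable_box. Qed.

Lemma lebesgue_box_lty ab : (mu (box ab) < +oo)%E.
Proof.
apply: (@le_lt_trans _ _ (box_volume ab)%:E); last exact: ltry.
apply: ereal_inf_lbound; exists [set ab]; last first.
  by rewrite esum_set1// lee_fin box_volume_ge0.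
by split; [exact: countable1|move=> x abx; exists ab].
Qed.

Lemma sub_cube_tile r N : 0 < r -> cube (r * N%:R) `<=` \bigcup_c @tile r N c.
Proof.
move=> r0 x xN.
have t0 (i : 'I_d) : 0 <= x 0 i / r + N%:R.
  have /andP[xi _] := xN i.
  by rewrite -lerBlDr sub0r ler_pdivlMr// mulrC mulrN.
have tN (i : 'I_d) : (Num.truncn (x 0 i / r + N%:R)%R < N + N)%N.
  have /andP[_ xi] := xN i.
  by rewrite truncn_lt_nat// natrD ltrD2r ltr_pdivrMr// mulrC.
exists [ffun i => Ordinal (tN i)] => // i; rewrite ffunE /=.
have /andP[a b] := truncn_itv (t0 i).
rewrite -ler_pdivlMl// -ltr_pdivrMl// (mulrC _ (x 0 i)).
by rewrite lerBlDr ltrBrDr a b.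
Qed.

Lemma tile_trivIset r N : 0 < r ->
  trivIset [set: {ffun 'I_d -> 'I_(N + N)}] (@tile r N).
Proof.
move=> r0 c c' _ _ [x [xc xc']]; apply/ffunP => i; apply/val_inj/eqP.
have /andP[a b] := xc i; have /andP[a' b'] := xc' i.
have := le_lt_trans a b'; have := le_lt_trans a' b.
rewrite !ltr_pM2l// !ltrD2r !ltr_nat !ltnS => h1 h2.
by rewrite eqn_leq h1 h2.
Qed.

Lemma tile_sub_cube r N (c : {ffun 'I_d -> 'I_(N + N)}) x y :
  tile r c x -> tile r c y -> cube r (y - x).
Proof.
move=> xc yc i; have := xc i; have := yc i; rewrite !mxE.
rewrite !mulrBr -natr1 mulrDr mulr1.
move: (r * (c i)%:R) (r * N%:R) => u v /andP[? ?] /andP[? ?].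
by apply/andP; split; lra.
Qed.

Lemma lebesgue_tile r N N' (c : {ffun 'I_d -> 'I_(N + N)})
  (c' : {ffun 'I_d -> 'I_(N' + N')}) : mu (tile r c) = mu (tile r c').
Proof.
pose h : 'rV[R]_d := \row_i (r * ((c' i)%:R - N'%:R) - r * ((c i)%:R - N%:R)).
rewrite -[RHS](outer_preimage_translate h); congr lebesgue_outer.
apply/seteqP; split => x xc i; have := xc i; rewrite !mxE !mulrBr -!natr1 !mulrDr !mulr1;
move: (r * (c i)%:R) (r * (c' i)%:R) (r * N%:R) (r * N'%:R) => u v w z /andP[? ?];
by apply/andP; split; lra.
Qed.

(** [-r, r)^d is the union of 2^d tiles of side r.  This ratio of measures
    keeps the error in [sampling] independent of r. *)
Lemma lebesgue_cube_le r N (c : {ffun 'I_d -> 'I_(N + N)}) : 0 < r ->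
  (mu (cube r) <= ((2 ^ d)%:R)%:E * mu (tile r c))%E.
Proof.
move=> r0; have /(le_lebesgue_outer) : cube r `<=`
    \big[setU/set0]_(c' : {ffun 'I_d -> 'I_(1 + 1)}) tile r c'.
  rewrite -[r in cube r]mulr1; apply: (subset_trans (@sub_cube_tile r 1 r0)).
  by move=> x [c' _ xc']; rewrite (bigD1 c')//=; left.
move=> /le_trans; apply.
apply: (@le_trans _ _ (\sum_(c' : {ffun 'I_d -> 'I_(1 + 1)}) mu (tile r c'))%E).
  elim/big_ind2 : _ => [|A a A' a' Aa A'a'|c' _//]; first by rewrite outer_measure0.
  by apply: le_trans (outer_measureU2 _ _ _) _; exact: leeD.
under eq_bigr do rewrite (lebesgue_tile _ _ c).
have tfin : mu (tile r c) \is a fin_num.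
  by rewrite ge0_fin_numE// tileE lebesgue_box_lty.
rewrite -(fineK tfin) sumEFin sumr_const card_ffun !card_ord -EFinM.
by rewrite mulr_natl.
Qed.

Lemma lebesgue_sigma_finite : sigma_finite [set: Rd R d] mu.
Proof.
exists (fun n => cube n%:R) => [|n]; last first.
  by split; [exact: measurable_cube|rewrite cubeE; exact: lebesgue_box_lty].
apply/seteqP; split => // x _.
exists (\max_(i < d) (Num.truncn `|(x : 'rV[R]_d) 0 i|%R).+1)%N => // i.
set m := (\max_(i < d) _)%N.
have : `|(x : 'rV[R]_d) 0 i| < m%:R.
  have /andP[_ /lt_le_trans] := truncn_itv (normr_ge0 ((x : 'rV[R]_d) 0 i)).
  apply; rewrite ler_nat.
  exact: (@leq_bigmax _ (fun i => (Num.truncn `|(x : 'rV[R]_d) 0 i|).+1)).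
by rewrite ltr_norml => /andP[/ltW -> ->].
Qed.

End boxes.

HB.instance Definition _ (R : realType) (d : nat) :=
  Measure_isSigmaFinite.Build _ _ _ (@lebesgueRd R d)
    (@lebesgue_sigma_finite R d).

(** * Borel versions of Bochner measurable functions *)

Section borel_versions.
Context {R : realType} {d : nat}.
Local Notation mu := (@lebesgueRd R d).

Lemma finite_range_preimage (disp : measure_display) (T : measurableType disp)
    (Z : Type) (s : T -> Z) (A : set Z) : finite_set (range s) ->
  (forall z, measurable (s @^-1` [set z])) -> measurable (s @^-1` A).
Proof.
move=> fs ms; rewrite (_ : s @^-1` A = \bigcup_(z in range s `&` A) s @^-1` [set z]).
  by apply: fin_bigcup_measurable => //; exact: finite_setIl.
apply/seteqP; split => [x Ax|x [z [_ Az] /= ->]//].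
by exists (s x) => //; split => //; exists x.
Qed.

Variable Z : normedModType R.

Definition borel_simple (s : Rd R d -> Z) : Prop :=
  finite_set (range s) /\ forall z, borel (s @^-1` [set z]).

Definition borel_limit (f : Rd R d -> Z) : Prop :=
  exists2 t : nat -> Rd R d -> Z, (forall n, borel_simple (t n)) &
    forall x, t n x @[n --> \oo] --> f x.

(** Each nonzero fibre of an approximating simple function has finite measure,
    so it differs from its Borel hull by a null set.  All these null sets and
    the set where convergence fails are contained in one Borel null set N0, and
    the functions are replaced by 0 on N0. *)
Lemma bochner_borel_limit (f : Rd R d -> Z) : bochner_measurable f ->
  exists2 f' : Rd R d -> Z, borel_limit f' & {ae mu, forall x, f' x = f x}.
Proof.
move=> [s ss [M0 [mM0 M00 sM0]]].
pose A n z : set (Rd R d) := s n @^-1` [set z].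
have hull n z := borel_hull (A n z).
pose A' n z := projT1 (cid (hull n z)).
have A'P n z : [/\ borel (A' n z), A n z `<=` A' n z &
    (lebesgue_outer (A' n z) <= lebesgue_outer (A n z))%E].
  by rewrite /A'; case: cid.
have A'0 n z : z != 0 -> mu (A' n z `\` A n z) = 0%E.
  move=> z0; have [bA' AA' A'A] := A'P n z.
  have [mA /(_ z0) Aoo] := (ss n).2 z.
  have mA' := borel_measurable bA'.
  have muD := @measureD _ _ _ mu _ _ mA' mA.
  have eA : mu (A' n z) = mu (A n z).
    by apply/eqP; rewrite eq_le A'A le_lebesgue_outer.
  rewrite muD; last exact: le_lt_trans A'A Aoo.
  rewrite (_ : A' n z `&` A n z = A n z); last first.
    by apply/seteqP; split => [x []//|x Ax]; split => //; exact: AA'.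
  have fA : mu (A n z) \is a fin_num by rewrite ge0_fin_numE.
  by rewrite -(subee fA); congr (_ - _)%E; exact: eA.
pose D n z := if z == 0 then set0 else A' n z `\` A n z.
have [N0 [bN0 N00 MN0]] : exists N0 : set 'rV[R]_d, [/\ borel N0, mu N0 = 0%E &
    M0 `|` \bigcup_n \bigcup_(z in range (s n)) D n z `<=` N0].
  apply: negligible_borel_hull; apply: negligibleU; first by exists M0; split.
  apply: negligible_bigcup => n.
  have /finite_seqP[r ->] := (ss n).1.
  rewrite bigcup_seq; elim/big_ind : _ => [|A1 A2 A10 A20|z _].
  - exact: negligible_set0.
  - exact: negligibleU.
  - rewrite /D; case: eqVneq => [_|z0]; first exact: negligible_set0.
    exists (A' n z `\` A n z); split => //; last exact: A'0.
    apply: measurableD; first by apply: borel_measurable; case: (A'P n z).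
    exact: ((ss n).2 z).1.
pose t n x := if x \in N0 then 0 else s n x.
pose f' x := if x \in N0 then 0 else f x.
have tN n z : z != 0 -> t n @^-1` [set z] =
    if z \in range (s n) then A' n z `\` N0 else set0.
  move=> z0; case: ifPn => [|] zs; apply/seteqP; split => x //=.
  - rewrite /t; case: ifPn => [_ /esym/eqP|]; first by rewrite (negbTE z0).
    rewrite notin_setE => xN <-; split => //.
    by case: (A'P n (s n x)) => _ AA' _; exact: AA'.
  - move=> [A'x xN]; rewrite /t ifN ?notin_setE//.
    apply: contrapT => sx; apply/xN/MN0; right; exists n => //.
    by exists z; [rewrite -inE|rewrite /D (negbTE z0)].
  - rewrite /t; case: ifPn => [_ /esym/eqP|_ sx]; first by rewrite (negbTE z0).
    by move: zs; rewrite notin_setE; apply; exists x.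
pose bT := g_sigma_algebraType (range (@box R d)).
have bt n z : z != 0 -> borel (t n @^-1` [set z]).
  move=> z0; rewrite tN//; case: ifPn => _; last exact: (@measurable0 _ bT).
  by apply: (@measurableD _ bT) => //; case: (A'P n z).
have ft n : finite_set (range (t n)).
  apply: (@sub_finite_set _ _ ([set 0] `|` range (s n))); last first.
    by rewrite finite_setU; split; [exact: finite_set1|exact: (ss n).1].
  by move=> _ [x _ <-]; rewrite /t; case: ifP => _; [left|right; exists x].
exists f'.
  exists t => [n|x].
    split=> // z; have [->|] := eqVneq z 0; last exact: bt.
    rewrite (_ : _ @^-1` _ = ~` \bigcup_(z in range (t n) `\ 0) t n @^-1` [set z]).
      apply: (@measurableC _ bT); apply: (@fin_bigcup_measurable _ bT).
        exact: finite_setD.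
      by move=> w [_ /= /eqP]; exact: bt.
    apply/seteqP; split => x /= => [tx0 [w [_ /= w0] /= txw]|nx].
      by apply: w0; rewrite -txw.
    apply: contrapT => tx0; apply: nx; exists (t n x) => //; split => //.
  have [xN|xN] := boolP (x \in N0).
    rewrite /f' xN (_ : (fun n => t n x) = fun=> 0); first exact: cvg_cst.
    by apply/funext => n; rewrite /t xN.
  rewrite /f' (negbTE xN) (_ : (fun n => t n x) = fun n => s n x); last first.
    by apply/funext => n; rewrite /t (negbTE xN).
  apply: contrapT => ncvg; move: xN; rewrite notin_setE; apply; apply: MN0.
  by left; apply: sM0.
exists N0; split => //; first exact: borel_measurable.
move=> x /= f'x; apply: contrapT => xN; apply: f'x; rewrite /f' ifN//.
by rewrite notin_setE.
Qed.

(** Measurability is with respect to the product of the two sigma-algebras, as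
    Tonelli's theorem requires; it follows from [borel_addition] applied to the
    fibres of the approximating functions. *)
Lemma measurable_norm_increment (f : Rd R d -> Z) : borel_limit f ->
  measurable_fun setT
    (fun u : Rd R d * Rd R d => `|f (translation u.2 u.1) - f u.1|).
Proof.
move=> [t bt tf].
apply: (@measurable_fun_cvg _ (Rd R d * Rd R d)%type R setT
    (fun n u => `|t n (translation u.2 u.1) - t n u.1|)) => [n|u _]; last first.
  by apply: cvg_norm; apply: cvgB; exact: tf.
move=> _ A _; rewrite setTI.
pose s (u : Rd R d * Rd R d) := (t n (translation u.2 u.1), t n u.1).
have [ft btn] := bt n.
apply: (@finite_range_preimage _ _ _ s [set w | A `|w.1 - w.2|]).
  apply: (@sub_finite_set _ _ (range (t n) `*` range (t n))).
    by move=> _ [u _ <-]; split; [exists (translation u.2 u.1)|exists u.1].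
  exact: finite_setX.
move=> [a b]; rewrite (_ : s @^-1` _ =
    (fun u : Rd R d * Rd R d => translation u.2 u.1) @^-1` (t n @^-1` [set a]) `&`
    (fun u : Rd R d * Rd R d => u.1) @^-1` (t n @^-1` [set b])).
  apply: measurableI; first exact: borel_addition (btn a).
  exact: borel_measurable_fst (btn b).
by apply/seteqP; split => u /= => [[-> ->]//|[<- <-]].
Qed.

Lemma borel_limit_cst (v : Z) : borel_limit (fun=> v).
Proof.
pose bT := g_sigma_algebraType (range (@box R d)).
exists (fun=> fun=> v) => [n|x]; last exact: cvg_cst.
split=> [|z]; first by apply: sub_finite_set (finite_set1 v) => _ [x _ <-].
have [<-|vz] := pselect (v = z).
  rewrite (_ : _ @^-1` _ = setT); first exact: (@measurableT _ bT).
  by apply/seteqP; split.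
rewrite (_ : _ @^-1` _ = set0); first exact: (@measurable0 _ bT).
by apply/seteqP; split.
Qed.

Lemma measurable_norm_sub_borel (f g : Rd R d -> Z) :
  borel_limit f -> borel_limit g -> measurable_fun setT (fun x => `|f x - g x|).
Proof.
move=> [t bt tf] [u bu ug].
apply: (@measurable_fun_cvg _ (Rd R d) R setT (fun n x => `|t n x - u n x|)) =>
    [n|x _]; last first.
  by apply: cvg_norm; apply: cvgB; [exact: tf|exact: ug].
move=> _ A _; rewrite setTI; have [ft btn] := bt n; have [fu bun] := bu n.
apply: (@finite_range_preimage _ _ _ (fun x => (t n x, u n x))
  [set w | A `|w.1 - w.2|]).
  apply: sub_finite_set (finite_setX ft fu).
  by move=> _ [x _ <-]; split; exists x.
move=> [a b]; rewrite (_ : _ @^-1` _ = t n @^-1` [set a] `&` u n @^-1` [set b]).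
  by apply: measurableI; apply: borel_measurable.
by apply/seteqP; split => x /= => [[-> ->]//|[<- <-]].
Qed.

Lemma ae_eq_measurable (f g : Rd R d -> R) :
  {ae mu, forall x, f x = g x} -> measurable_fun setT f -> measurable_fun setT g.
Proof.
move=> fg mf; apply/measurable_EFinP.
apply: (ae_measurable_fun (@lebesgueRd_is_complete R d) (f := EFin \o f)).
  by apply: filterS fg => x /= -> _.
exact/measurable_EFinP.
Qed.

Lemma measurable_norm_sub_cst (f : Rd R d -> Z) (v : Z) : bochner_measurable f ->
  measurable_fun setT (fun x => `|f x - v|).
Proof.
move=> /bochner_borel_limit[f' bf' ff'].
apply: ae_eq_measurable (measurable_norm_sub_borel bf' (borel_limit_cst v)).
by apply: filterS ff' => x ->.
Qed.

Lemma measurable_norm_sub (f g : Rd R d -> Z) : bochner_measurable f ->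
  bochner_measurable g -> measurable_fun setT (fun x => `|f x - g x|).
Proof.
move=> /bochner_borel_limit[f' bf' ff'] /bochner_borel_limit[g' bg' gg'].
apply: ae_eq_measurable (measurable_norm_sub_borel bf' bg').
by apply: filterS2 ff' gg' => x -> ->.
Qed.

Lemma measurable_norm_translate (f : Rd R d -> Z) (h : 'rV[R]_d) :
  bochner_measurable f ->
  measurable_fun setT (fun x => `|f (translation h x) - f x|).
Proof.
move=> /bochner_borel_limit[f' bf' ff'].
apply: (ae_eq_measurable (f := fun x => `|f' (translation h x) - f' x|)).
  have := @ae_translate R d h _ ff'.
  by apply: filterS2 ff' => x e1; rewrite /translation => ->; rewrite e1.
exact: (measurable_fun_pair1 (h : Rd R d) (measurable_norm_increment bf')).
Qed.

End borel_versions.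

(** * Powers and averages *)

Section power_integrals.
Context {R : realType}.

Lemma powR_add_le (p a b : R) : 0 <= p -> 0 <= a -> 0 <= b ->
  (a + b) `^ p <= 2 `^ p * (a `^ p + b `^ p).
Proof.
move=> p0 a0 b0.
apply: (@le_trans _ _ ((2 * Num.max a b) `^ p)).
  apply: ge0_ler_powR => //; rewrite ?nnegrE ?addr_ge0// ?mulr_ge0// ?le_max ?a0//.
  by rewrite mulr_natl mulr2n lerD// le_max lexx ?orbT.
rewrite powRM// ?le_max ?a0//; apply: ler_wpM2l; first exact: powR_ge0.
by case: (leP a b) => _; rewrite ?lerDl ?lerDr powR_ge0.
Qed.

(** If f exceeded its average c almost everywhere on E, the integral over E of
    |f - c| = f - c would vanish, so f would equal c almost everywhere on E.
    The almost sure property P is carried along because the sampling points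
    have to avoid a null set. *)
Lemma exists_le_average (disp : measure_display) (T : measurableType disp)
    (mu : {measure set T -> \bar R}) (E : set T) (f : T -> \bar R)
    (P : T -> Prop) :
  measurable E -> (0 < mu E < +oo)%E -> measurable_fun E f ->
  (forall x, E x -> (0 <= f x)%E) -> {ae mu, forall x, P x} ->
  exists2 x, E x /\ P x & (mu E * f x <= \int[mu]_(y in E) f y)%E.
Proof.
move=> mE /andP[E0 Eoo] mf f0 aeP.
set I := (\int[mu]_(y in E) f y)%E.
apply: contrapT => nex.
have fgt x : E x -> P x -> (I < mu E * f x)%E.
  by move=> Ex Px; rewrite ltNge; apply/negP => fx; apply: nex; exists x.
have nE : ~ mu.-negligible E.
  by move=> /(negligibleP mu mE) E00; rewrite E00 ltxx in E0.
have Efin : mu E \is a fin_num by rewrite ge0_fin_numE// ltW.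
have I0 : (0 <= I)%E by exact: integral_ge0.
have Ifin : I \is a fin_num.
  rewrite ge0_fin_numE//; apply: contrapT => Ioo; apply: nE.
  case: aeP => N [mN N0 PN]; exists N; split => // x Ex; apply: PN => Px.
  by apply: Ioo; rewrite (lt_le_trans (fgt _ Ex Px))// leey.
pose c := fine I / fine (mu E).
have m0 : 0 < fine (mu E) by apply: fine_gt0; rewrite E0.
have c0 : 0 <= c by rewrite divr_ge0// ?fine_ge0// ltW.
have fc x : E x -> P x -> (c%:E < f x)%E.
  move=> Ex /(fgt _ Ex); rewrite -(fineK Efin) -(fineK Ifin) /c.
  case: (f x) (f0 _ Ex) => [s s0|_ _|//]; last exact: ltry.
  by rewrite -EFinM !lte_fin ltr_pdivrMr// mulrC.
have mfc : measurable_fun E (fun x => f x - c%:E)%E.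
  by apply: emeasurable_funB => //; exact: measurable_cst.
pose u x := `|f x - c%:E|%E.
have mu_ : measurable_fun E u.
  exact: measurableT_comp mfc.
have Iu : I = (\int[mu]_(x in E) u x + I)%E.
  have cI : (c%:E * mu E)%E = I.
    by rewrite -(fineK Efin) -(fineK Ifin) -EFinM divfK// gt_eqF.
  rewrite -[X in (_ + X)%E]cI -integral_cst// -ge0_integralD//.
  apply: ge0_ae_eq_integral => //.
  - by apply: emeasurable_funD => //; exact: measurable_cst.
  - by move=> x Ex; apply: adde_ge0; [exact: abse_ge0|rewrite lee_fin].
  - apply: filterS aeP => x Px Ex; rewrite /u gee0_abs ?subeK//.
    by rewrite sube_ge0// ltW// fc.
  - by move=> x _; exact: abse_ge0.
have u0 : (\int[mu]_(x in E) `|f x - c%:E|)%E = 0%E.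
  have : (I - I = (\int[mu]_(x in E) u x + I) - I)%E by rewrite -Iu.
  by rewrite subee// addeK.
move/(ae_eq_integral_abs mu mE) : u0 => u0.
apply: nE; have {}u0 : ae_eq mu E (fun x => f x - c%:E)%E (cst 0%E).
  by exact: u0.
have [N [mN N0 PN]] : {ae mu, forall x, ~ E x}.
  apply: filterS2 u0 aeP => x /= fx Px Ex.
  by have := fc _ Ex Px; rewrite -sube_gt0 (fx Ex) ltxx.
by exists N; split => // x Ex; apply: PN => /(_ Ex).
Qed.

End power_integrals.

(** * Sampling a function at one point of each tile *)

Section sampling.
Context {R : realType} {d : nat} {Z : normedModType R}.
Local Notation mu := (@lebesgueRd R d).

Lemma translationC (x y : Rd R d) : translation x y = translation y x.
Proof. exact: addrC. Qed.

Lemma measurable_norm_sub_cst_pow (p : R) (f : Rd R d -> Z) (v : Z)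
    (D : set (Rd R d)) : bochner_measurable f ->
  measurable_fun D (fun x => (`|f x - v| `^ p)%:E).
Proof.
move=> mf; apply: measurable_funTS; apply/measurable_EFinP.
exact: measurableT_comp (measurable_powR p) (measurable_norm_sub_cst v mf).
Qed.

Lemma measurable_norm_sub_pow (p : R) (f g : Rd R d -> Z)
    (D : set (Rd R d)) : bochner_measurable f -> bochner_measurable g ->
  measurable_fun D (fun x => (`|f x - g x| `^ p)%:E).
Proof.
move=> mf mg; apply: measurable_funTS; apply/measurable_EFinP.
exact: measurableT_comp (measurable_powR p) (measurable_norm_sub mf mg).
Qed.

Lemma measurable_norm_pow (p : R) (f : Rd R d -> Z) (D : set (Rd R d)) :
  bochner_measurable f -> measurable_fun D (fun x => (`|f x| `^ p)%:E).
Proof.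
move=> /(@measurable_norm_sub_cst_pow p _ 0 D); congr measurable_fun.
by apply/funext => x; rewrite subr0.
Qed.

Lemma measurable_norm_translate_pow (p : R) (f : Rd R d -> Z) (h : 'rV[R]_d)
    (D : set (Rd R d)) : bochner_measurable f ->
  measurable_fun D (fun x => (`|f (translation h x) - f x| `^ p)%:E).
Proof.
move=> mf; apply: measurable_funTS; apply/measurable_EFinP.
exact: measurableT_comp (measurable_powR p) (measurable_norm_translate h mf).
Qed.

(** The term with tau lets a single choice of the points y control both the
    error of the step function and the gauges of its values; tau is chosen
    afterwards, in [cone_sampling]. *)
Lemma sampling (p : R) (f : Rd R d -> Z) (g : Rd R d -> R) (r w M tau : R)
    (N : nat) : bochner_measurable f -> measurable_fun setT g ->
  (forall x, 0 <= g x) -> 0 < r -> 0 <= tau ->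
  (forall h, cube r h ->
    (\int[mu]_x (`|f (translation h x) - f x| `^ p)%:E <= w%:E)%E) ->
  (\int[mu]_x (g x `^ p)%:E <= M%:E)%E ->
  (forall c : {ffun 'I_d -> 'I_(N + N)}, (0 < mu (tile r c))%E) ->
  exists y : {ffun 'I_d -> 'I_(N + N)} -> Rd R d,
    (\sum_c mu (tile r c) * (\int[mu]_(x in tile r c)
        (`|f x - f (y c)| `^ p)%:E + (tau * g (y c) `^ p)%:E) <=
      w%:E * mu (cube r) + (tau * M)%:E)%E.
Proof.
move=> bf mg g0 r0 tau0 fw gM tpos.
have [f' bf' ff'] := bochner_borel_limit bf.
(* K (x, h) is the p-th power of the increment of f' from x to x + h, cut off to
   h in the cube; H x is its integral over h. *)
pose k (u : Rd R d * Rd R d) : R :=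
  `|f' (translation u.2 u.1) - f' u.1| `^ p * \1_(cube r : set (Rd R d)) u.2.
pose K u := (k u)%:E.
have K0 u : (0 <= K u)%E by rewrite lee_fin mulr_ge0 ?powR_ge0.
have mK : measurable_fun setT K.
  apply/measurable_EFinP; apply: measurable_funM.
    exact: measurableT_comp (measurable_powR p) (measurable_norm_increment bf').
  apply: measurableT_comp measurable_snd.
  by apply: measurable_indic; exact: measurable_cube.
pose H x := (\int[mu]_h K (x, h))%E.
have H0 x : (0 <= H x)%E by exact: integral_ge0.
have mH : measurable_fun setT H := @measurable_fun_fubini_tonelli_F _ _ _ _ _ mu K mK K0.
have intw (h : Rd R d) :
    (\int[mu]_x K (x, h) <= ((fun=> w%:E) \_ (cube r : set (Rd R d))) h)%E.
  rewrite patchE; case: ifPn => [/set_mem hr|hr]; last first.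
    by rewrite integral0_eq// => x _; rewrite /K /k indicE (negbTE hr) mulr0.
  apply: le_trans (fw h hr); rewrite le_eqVlt; apply/orP; left; apply/eqP.
  apply: ge0_ae_eq_integral.
  - exact: measurableT.
  - exact: (measurable_fun_pair1 (h : Rd R d) mK).
  - exact: measurable_norm_translate_pow.
  - by move=> x _; exact: K0.
  - by move=> x _; rewrite lee_fin powR_ge0.
  - have := ae_translate h ff'; apply: filterS2 ff' => x e1 e2 _.
    by rewrite /K /k /= indicE mem_set// mulr1 e1 /translation e2.
have intH : (\int[mu]_x H x <= w%:E * mu (cube r))%E.
  rewrite /H (@fubini_tonelli _ _ _ _ _ mu mu K mK K0) -integral_cst;
    last exact: measurable_cube.
  rewrite [leRHS]integral_mkcond; apply: ge0_le_integral.
  - exact: measurableT.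
  - by move=> h _; apply: integral_ge0 => x _; exact: K0.
  - exact: (@measurable_fun_fubini_tonelli_G _ _ _ _ _ mu K mK K0).
  - apply/(measurable_restrictT _ (measurable_cube r)).
    exact: measurable_cst.
  - by move=> h _; exact: intw.
pose T x := (H x + (tau * g x `^ p)%:E)%E.
have mgp : measurable_fun setT (fun x => (tau * g x `^ p)%:E).
  apply/measurable_EFinP; apply: measurable_funM; first exact: measurable_cst.
  exact: measurableT_comp (measurable_powR p) mg.
have gp0 x : (0 <= (tau * g x `^ p)%:E)%E by rewrite lee_fin mulr_ge0// powR_ge0.
have T0 x : (0 <= T x)%E by exact: adde_ge0.
have mT : measurable_fun setT T by exact: emeasurable_funD.
have intT : (\int[mu]_x T x <= w%:E * mu (cube r) + (tau * M)%:E)%E.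
  rewrite ge0_integralD//; apply: leeD => //.
  under eq_integral do rewrite EFinM.
  have mp : measurable_fun setT (fun x => (g x `^ p)%:E).
    by apply/measurable_EFinP; exact: measurableT_comp (measurable_powR p) mg.
  rewrite (ge0_integralZl mu measurableT mp); last 2 first.
  - by move=> x _; rewrite lee_fin powR_ge0.
  - by rewrite lee_fin.
  by rewrite EFinM; apply: lee_wpmul2l; rewrite ?lee_fin.
have sample (c : {ffun 'I_d -> 'I_(N + N)}) :
    exists y : Rd R d, (tile r c y /\ f' y = f y) /\
    (mu (tile r c) * T y <= \int[mu]_(x in tile r c) T x)%E.
  have tc : (0 < mu (tile r c) < +oo)%E.
    by apply/andP; split; [exact: tpos|rewrite tileE; exact: lebesgue_box_lty].
  have mTc : measurable_fun (tile r c : set (Rd R d)) T by exact: measurable_funTS.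
  have T0c x : tile r c x -> (0 <= T x)%E by move=> _; exact: T0.
  have [y yc Ty] := @exists_le_average R _ (Rd R d) mu (tile r c) T _
    (measurable_tile r c) tc mTc T0c ff'.
  by exists y; split.
have [y yP] := choice sample.
exists y.
have fT (c : {ffun 'I_d -> 'I_(N + N)}) :
    (\int[mu]_(x in tile r c) (`|f x - f (y c)| `^ p)%:E <= H (y c))%E.
  have [[yc fyc] _] := yP c.
  have mt : measurable (translation (y c) @^-1` tile r c).
    exact: measurable_translate_preimage (measurable_tile r c).
  rewrite -(@ge0_integral_translate _ _ (y c) _ _ (measurable_tile r c)); last 2 first.
  - exact: measurable_norm_sub_cst_pow.
  - by move=> x _; rewrite lee_fin powR_ge0.
  rewrite integral_mkcond; apply: ae_ge0_le_integral.
  - exact: measurableT.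
  - by move=> h _; rewrite patchE; case: ifP => // _; rewrite lee_fin powR_ge0.
  - apply/(measurable_restrictT _ mt).
    apply: measurable_funTS.
    apply: (measurableT_comp (f := fun x => (`|f x - f (y c)| `^ p)%:E) _
      (measurable_translate (y c))).
    exact: measurable_norm_sub_cst_pow.
  - by move=> h _; exact: K0.
  - by have := measurable_fun_pair2 (y c : Rd R d) mK.
  - have := ae_translate (y c) ff'; apply: filterS2 ff' => h _ e1 _.
    rewrite patchE; case: ifPn => [/set_mem hc|_]; last exact: K0.
    rewrite /K /k /= indicE mem_set ?mulr1.
      by rewrite [translation h _]translationC fyc /translation e1.
    have := tile_sub_cube yc hc.
    by rewrite /translation addrK.
apply: le_trans intT.
apply: (@le_trans _ _ (\sum_c \int[mu]_(x in tile r c) T x)%E).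
  apply: lee_sum => c _; apply: le_trans (yP c).2.
  by apply: lee_wpmul2l => //; exact: leeD2r.
rewrite -ge0_integral_bigsetU//; last 4 first.
- exact: measurable_tile.
- exact: index_enum_uniq.
- by apply: sub_trivIset (@tile_trivIset R d r N r0) => c.
- exact: measurable_funTS.
apply: ge0_subset_integral => //.
by apply: bigsetU_measurable => c _; exact: measurable_tile.
Qed.

End sampling.

(** * Compactly gauged cones *)

Section gauged_cones.
Context {R : realType}.

(** Without a finite net, points at mutual distance at least e can be chosen
    one after the other, and no subsequence of them is Cauchy. *)
Lemma seq_precompact_net (V : normedModType R) (K : set V) (e : R) :
  seq_precompact K -> 0 < e ->
  exists s : seq V, forall x, K x -> exists2 b, b \in s & `|x - b| < e.
Proof.
move=> cK e0; apply: contrapT => nonet.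
have far (s : seq V) : exists x, K x /\ forall b, b \in s -> e <= `|x - b|.
  apply: contrapT => nx; apply: nonet; exists s => x Kx.
  apply: contrapT => nb; apply: nx; exists x; split => // b bs.
  by rewrite leNgt; apply/negP => xb; apply: nb; exists b.
have [next nextP] := choice far.
(* l n lists, latest first, the n points chosen so far. *)
pose l := fix l n := if n is m.+1 then next (l m) :: l m else [::].
pose u n := next (l n).
have ul m n : (m < n)%N -> u m \in l n.
  elim: n => // n IH; rewrite ltnS leq_eqVlt => /orP[/eqP <-|/IH h].
    by rewrite /= inE eqxx.
  by rewrite /= inE h orbT.
have [k kmono [x ux]] := cK u (fun n => (nextP (l n)).1).
have /cvgrPdist_lt/(_ (e / 2)) := ux.
rewrite divr_gt0// => /(_ isT)[N _ uN].
have h1 := uN N (leqnn N); have h2 := uN N.+1 (leqnSn N).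
have := (nextP (l (k N.+1))).2 _ (ul _ _ (kmono _ _ (ltnSn N))).
rewrite leNgt => /negP; apply.
rewrite -/(u (k N.+1)) (_ : u (k N.+1) - u (k N) = (x - u (k N)) - (x - u (k N.+1))).
  by rewrite (le_lt_trans (ler_normB _ _))// (splitr e) ltrD.
by rewrite opprB [RHS]addrC addrA subrK.
Qed.

Lemma increasing_geq (k : nat -> nat) : {homo k : m n / (m < n)%N} ->
  forall n, (n <= k n)%N.
Proof.
by move=> kmono; elim=> // n IH; apply: (leq_ltn_trans IH); exact: kmono.
Qed.

Lemma cvg_increasing (k : nat -> nat) : {homo k : m n / (m < n)%N} ->
  k n @[n --> \oo] --> \oo.
Proof.
move=> /increasing_geq kn A [N _ NA]; exists N => // n /= Nn.
by apply: NA; exact: leq_trans (kn n).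
Qed.

Variables (B : normedModType R) (X : set B) (gauge : B -> R).
Hypothesis cone : compactly_gauged_cone X gauge.

Lemma cone0 : X 0.
Proof. by have [[[x Xx] h] _ _] := cone; rewrite -(scale0r x); exact: h. Qed.

Lemma gauge0 : gauge 0 = 0.
Proof.
have [_ [_ gZ _] _] := cone.
by rewrite -{1}(scale0r 0) gZ ?mul0r//; exact: cone0.
Qed.

Lemma coneZ (a : R) x : 0 <= a -> X x -> X (a *: x).
Proof. by have [[_ h] _ _] := cone; exact: h. Qed.

Lemma gauge_ge0 x : X x -> 0 <= gauge x.
Proof. by have [_ [h _ _] _] := cone; exact: h. Qed.

Lemma gaugeZ (a : R) x : 0 <= a -> X x -> gauge (a *: x) = a * gauge x.
Proof. by have [_ [_ h _] _] := cone; exact: h. Qed.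

Lemma gauge_eq0 x : X x -> gauge x <= 0 -> x = 0.
Proof.
have [_ [_ _ h] _] := cone => Xx gx; apply: contrapT => /eqP x0.
by have := h _ Xx x0; rewrite ltNge gx.
Qed.

Lemma gauge_ball_net (L e : R) : 0 < L -> 0 < e ->
  exists s : seq B, forall x, X x -> gauge x <= L ->
    exists2 b, b \in s & `|x - b| < e.
Proof.
move=> L0 e0; have [_ _ cK] := cone.
have [s sP] := seq_precompact_net cK (divr_gt0 e0 L0).
exists [seq L *: b | b <- s] => x Xx gx.
have [|b bs xb] := sP (L^-1 *: x).
  split; first by apply: coneZ => //; rewrite invr_ge0 ltW.
  by rewrite gaugeZ ?invr_ge0 ?(ltW L0)// mulrC ler_pdivrMr// mul1r.
exists (L *: b); first exact: map_f.
have -> : x - L *: b = L *: (L^-1 *: x - b).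
  by rewrite scalerBr scalerA divff ?scale1r// gt_eqF.
by rewrite normrZ gtr0_norm// mulrC -ltr_pdivlMr.
Qed.

(** A finite net of the unit gauge ball with radius 1 bounds its norms. *)
Lemma le_norm_gauge : exists2 C : R, 0 < C & forall x, X x -> `|x| <= C * gauge x.
Proof.
have [_ _ cK] := cone.
have [s sP] := seq_precompact_net cK (@ltr01 R).
pose C := 1 + \sum_(b <- s) `|b|.
have C0 : 0 < C by rewrite ltr_wpDr// sumr_ge0.
exists C => // x Xx.
have [gx0|gx0] := leP (gauge x) 0.
  by rewrite (gauge_eq0 Xx gx0) normr0 gauge0 mulr0.
have [|b bs xb] := sP ((gauge x)^-1 *: x).
  split; first by apply: coneZ => //; rewrite invr_ge0 ltW.
  by rewrite gaugeZ ?invr_ge0 ?(ltW gx0)// mulVf ?gt_eqF.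
rewrite -ler_pdivrMr// mulrC -[X in X * _](@gtr0_norm _ (gauge x)^-1) ?invr_gt0//.
rewrite -normrZ -[X in `|X|](subrK b) (le_trans (ler_normD _ _))// lerD ?(ltW xb)//.
by rewrite (big_rem b bs) /= lerDl sumr_ge0.
Qed.

Variables (V : lmodType R) (Y : normedModType R).
Variables (iB : {linear B -> V}) (iY : {linear Y -> V}).
Hypothesis sep : no_separating_sequence iB iY.

(** By homogeneity a failure for every C may be normalized to pairs in the unit
    gauge ball.  Along a subsequence both components converge in B; the
    differences are bounded in B, hence tend to 0 in Y, while their limit in B
    has norm at least e: this is a separating sequence. *)
Lemma gauge_interpolation (e : R) : 0 < e ->
  exists2 C : R, 0 < C & forall x y w, X x -> X y -> iY w = iB (x - y) ->
    `|x - y| <= e * (gauge x + gauge y) + C * `|w|.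
Proof.
move=> e0; apply: contrapT => noC.
have bad (n : nat) : exists u : B * B * Y,
    [/\ X u.1.1 /\ gauge u.1.1 <= 1, X u.1.2 /\ gauge u.1.2 <= 1,
        iY u.2 = iB (u.1.1 - u.1.2) &
        e + n.+1%:R * `|u.2| < `|u.1.1 - u.1.2|].
  apply: contrapT => nbad; apply: noC; exists n.+1%:R; first by rewrite ltr0n.
  move=> x y w Xx Xy wxy; rewrite leNgt; apply/negP => xyw.
  have gx := gauge_ge0 Xx; have gy := gauge_ge0 Xy.
  have [s0|s0] := leP (gauge x + gauge y) 0.
    have x0 : x = 0 by apply: gauge_eq0 => //; rewrite (le_trans _ s0)// lerDl.
    have y0 : y = 0 by apply: gauge_eq0 => //; rewrite (le_trans _ s0)// lerDr.
    move: xyw; rewrite x0 y0 subr0 normr0 ltNge gauge0 addr0 mulr0 add0r.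
    by rewrite mulr_ge0.
  (* Division by gauge x + gauge y brings both points into the unit ball. *)
  pose a := (gauge x + gauge y)^-1; have a0 : 0 < a by rewrite invr_gt0.
  have a0' := ltW a0.
  apply: nbad; exists (a *: x, a *: y, a *: w); split => /=.
  - split; first exact: coneZ.
    by rewrite gaugeZ// mulrC ler_pdivrMr// mul1r lerDl.
  - split; first exact: coneZ.
    by rewrite gaugeZ// mulrC ler_pdivrMr// mul1r lerDr.
  - by rewrite -scalerBr !linearZ /= wxy.
  - rewrite -scalerBr !normrZ gtr0_norm// mulrCA.
    rewrite -(ltr_pM2l a0) mulrDr mulrCA mulVf ?gt_eqF// mulr1 in xyw.
    exact: xyw.
have [u uP] := choice bad.
have [_ _ cK] := cone.
have [k1 k1m [lx xlx]] := cK (fun n => (u n).1.1)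
  (fun n => let: And4 h _ _ _ := uP n in h).
have [k2 k2m [ly yly]] := cK (fun n => (u (k1 n)).1.2)
  (fun n => let: And4 _ h _ _ := uP (k1 n) in h).
pose k n := k1 (k2 n).
pose b n := (u (k n)).1.1 - (u (k n)).1.2.
have bl : b n @[n --> \oo] --> lx - ly.
  apply: cvgB => //.
  exact: (cvg_comp _ _ (cvg_increasing k2m) xlx).
have kn n : (n <= k n)%N.
  exact: leq_trans (increasing_geq k2m n) (increasing_geq k1m _).
have wb n : `|(u (k n)).2| <= `|b n| * n.+1%:R^-1.
  have [_ _ _ h] := uP (k n).
  rewrite ler_pdivlMr ?ltr0n// mulrC; apply/ltW/(le_lt_trans _ h).
  apply: (@le_trans _ _ ((k n).+1%:R * `|(u (k n)).2|)).
    by apply: ler_wpM2r => //; rewrite ler_nat ltnS.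
  by rewrite lerDr ltW.
have be n : e <= `|b n|.
  have [_ _ _ h] := uP (k n); apply/ltW/(le_lt_trans _ h).
  by rewrite lerDl mulr_ge0.
apply: sep; exists b, (fun n => (u (k n)).2), (lx - ly); split => //.
- by move=> n; have [_ _ h _] := uP (k n).
- apply: norm_cvg0.
  have h0 : `|b n| * n.+1%:R^-1 @[n --> \oo] --> (0 : R).
    rewrite -(mulr0 `|lx - ly|); apply: cvgM; first exact: cvg_norm.
    exact: cvg_harmonic.
  apply: (squeeze_cvgr _ (cvg_cst 0) h0); apply: nearW => n.
  by rewrite normr_ge0 wb.
- apply/eqP => l0; rewrite l0 in bl.
  have [N _ /(_ N (leqnn N))] := (cvgrPdist_lt b 0).1 bl e e0.
  by rewrite /= sub0r normrN ltNge be.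
Qed.

End gauged_cones.

(** * Norms and integrals over tiles *)

Section Lp_tools.
Context {R : realType} {d : nat}.
Local Notation mu := (@lebesgueRd R d).

Lemma Lnorm_le (p c : R) (u : Rd R d -> R) : 0 < p -> 0 <= c ->
  (forall x, 0 <= u x) ->
  (Lnorm mu p%:E (fun x => (u x)%:E) <= c%:E)%E =
  (\int[mu]_x (u x `^ p)%:E <= (c `^ p)%:E)%E.
Proof.
move=> p0 c0 u0; have pn0 : p != 0 by rewrite gt_eqF.
rewrite unlock; under eq_integral do rewrite abse_EFin ger0_norm// poweR_EFin.
set I := (\int[mu]_x _)%E.
have I0 : (0 <= I)%E by apply: integral_ge0 => x _; rewrite lee_fin powR_ge0.
have mem (a : \bar R) : (0 <= a)%E -> a \in `[0%E, +oo%E].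
  by move=> a0; rewrite in_itv /= a0 leey.
have c0' : (0 <= c%:E)%E by rewrite lee_fin.
apply/idP/idP => [Ic|Ic].
- rewrite -poweR_EFin -[leLHS]poweRe1// -[1](mulVf pn0) poweRrM.
  by apply: (gt0_ler_poweR (ltW p0)) => //; apply: mem => //; exact: poweR_ge0.
- rewrite -[leRHS]poweRe1// -[1](mulfV pn0) poweRrM poweR_EFin.
  apply: gt0_ler_poweR => //; first by rewrite invr_ge0 ltW.
    exact: mem.
  by apply: mem; rewrite lee_fin powR_ge0.
Qed.

Lemma le_euclid (x : 'rV[R]_d) i : `|x 0 i| <= euclid x.
Proof.
rewrite -sqrtr_sqr ler_sqrt ?sumr_ge0// => [|j _]; last exact: sqr_ge0.
by rewrite (bigD1 i)//= lerDl sumr_ge0// => j _; exact: sqr_ge0.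
Qed.

Lemma euclid_lt_cube (x : 'rV[R]_d) a : euclid x < a -> cube a x.
Proof.
move=> xa i; have := le_lt_trans (le_euclid x i) xa.
by rewrite ltr_norml => /andP[/ltW -> ->].
Qed.

Lemma cube_euclid_lt (x : 'rV[R]_d) r : 0 < r -> cube r x ->
  euclid x < r * d.+1%:R.
Proof.
move=> r0 xr; have rd0 : 0 < r * d.+1%:R by rewrite mulr_gt0// ltr0n.
rewrite -(gtr0_norm rd0) -sqrtr_sqr ltr_sqrt ?exprn_gt0//.
apply: (@le_lt_trans _ _ (\sum_(i < d) r ^+ 2)).
  apply: ler_sum => i _; have /andP[a b] := xr i.
  by rewrite -subr_ge0 subr_sqr mulr_ge0//; lra.
rewrite sumr_const card_ord -[X in X < _]mulr_natr exprMn ltr_pM2l ?exprn_gt0//.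
rewrite expr2 -natrM ltr_nat.
by rewrite mulnS addSn ltnS leq_addr.
Qed.

Lemma measurable_euclid : measurable_fun setT (euclid : Rd R d -> R).
Proof.
apply: (@measurableT_comp _ _ _ _ _ _ (@Num.sqrt R)).
  by apply: continuous_measurable_fun; exact: sqrt_continuous.
by apply: measurable_sum => i; apply: measurable_funX; exact: measurable_coord.
Qed.

Lemma integral_le_tiles (r : R) (N : nat) (f : Rd R d -> \bar R) : 0 < r ->
  measurable_fun setT f -> (forall x, (0 <= f x)%E) ->
  (\int[mu]_x f x <= \sum_(c : {ffun 'I_d -> 'I_(N + N)})
     \int[mu]_(x in tile r c) f x +
   \int[mu]_(x in ~` (cube (r * N%:R) : set (Rd R d))) f x)%E.
Proof.
move=> r0 mf f0.
pose U : set (Rd R d) := \big[setU/set0]_(c : {ffun 'I_d -> 'I_(N + N)}) tile r c.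
have mU : measurable U.
  by apply: bigsetU_measurable => c _; exact: measurable_tile.
rewrite -(setUv U) (ge0_integral_setU mu mU (measurableC mU)); last 3 first.
- exact: measurable_funTS.
- by move=> x _; exact: f0.
- exact/disj_setPCl.
apply: leeD.
  rewrite ge0_integral_bigsetU//.
  - exact: measurable_tile.
  - exact: index_enum_uniq.
  - by apply: sub_trivIset (@tile_trivIset R d r N r0) => c.
  - exact: measurable_funTS.
apply: ge0_subset_integral => //.
- exact: measurableC.
- by apply: measurableC; exact: measurable_cube.
- exact: measurable_funTS.
- apply: subsetC => x /(sub_cube_tile r0) [c _ xc].
  by rewrite /U (bigD1 c)//=; left.
Qed.

End Lp_tools.

(** * Step approximations with values in a fixed gauge ball *)

Section cone_sampling.
Context {R : realType} {d : nat} {B : normedModType R}.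
Variables (X : set B) (gauge : B -> R).
Hypothesis cone : compactly_gauged_cone X gauge.
Local Notation mu := (@lebesgueRd R d).

(** The bound L is chosen before f: this uniformity is what lets one finite net
    serve the whole family.  The first eta / 2 of the error comes from the
    increments of f and the second one from the weight of the gauge. *)
Lemma cone_sampling (p r M eta : R) (N : nat) : 0 < p -> 0 < r -> 0 <= M ->
  0 < eta -> exists2 L : R, 0 < L & forall f : Rd R d -> B,
  Lp_cone X gauge p f ->
  (\int[mu]_x (gauge (f x) `^ p)%:E <= M%:E)%E ->
  (forall h, cube r h -> (\int[mu]_x (`|f (translation h x) - f x| `^ p)%:E <=
    (eta / (2 * 2 ^+ d))%:E)%E) ->
  exists v : {ffun 'I_d -> 'I_(N.+1 + N.+1)} -> B,
    (forall c, X (v c) /\ gauge (v c) <= L) /\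
    (\sum_c \int[mu]_(x in tile r c) (`|f x - v c| `^ p)%:E <= eta%:E)%E.
Proof.
move=> p0 r0 M0 eta0.
pose c0 : {ffun 'I_d -> 'I_(N.+1 + N.+1)} := [ffun => ord0].
have tE (c : {ffun 'I_d -> 'I_(N.+1 + N.+1)}) :
    mu (tile r c) = mu (tile r c0) by exact: lebesgue_tile.
have tfin : mu (tile r c0) \is a fin_num.
  by rewrite ge0_fin_numE ?measure_ge0// tileE; exact: lebesgue_box_lty.
pose m := fine (mu (tile r c0)).
have mE : mu (tile r c0) = m%:E by rewrite fineK.
(* On null tiles any value in the cone will do. *)
have [m0|m0] := leP m 0.
  exists 1 => // f [fX bf mg _] _ _; exists (fun=> 0); split.
    by move=> c; rewrite (gauge0 cone) ler01; split => //; exact: cone0 cone.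
  rewrite big1 ?lee_fin ?(ltW eta0)// => c _; apply: null_set_integral.
  - exact: measurable_tile.
  - exact: measurable_norm_sub_cst_pow.
  - apply/eqP; rewrite eq_le measure_ge0 andbT.
    suff h : (mu (tile r c) <= 0)%E by exact: h.
    by rewrite tE mE lee_fin.
pose tau := eta * m / (2 * (M + 1)).
have M10 : 0 < M + 1 by rewrite ltr_wpDl.
have tau0 : 0 < tau by rewrite divr_gt0 ?mulr_gt0.
exists ((2 * (M + 1) / m) `^ p^-1) => [|f [fX bf mg _] gM fw].
  by rewrite powR_gt0// divr_gt0 ?mulr_gt0.
have w0 : 0 <= eta / (2 * 2 ^+ d).
  by apply: divr_ge0; [exact: ltW|rewrite mulr_ge0// exprn_ge0].
have g0 x : 0 <= gauge (f x) by exact: gauge_ge0 cone _ (fX x).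
have tpos (c : {ffun 'I_d -> 'I_(N.+1 + N.+1)}) : (0 < mu (tile r c))%E.
  by rewrite tE mE lte_fin.
have [y yP] := sampling bf mg g0 r0 (ltW tau0) fw gM tpos.
pose A (c : {ffun 'I_d -> 'I_(N.+1 + N.+1)}) :=
  (\int[mu]_(x in tile r c) (`|f x - f (y c)| `^ p)%:E +
  (tau * gauge (f (y c)) `^ p)%:E)%E.
have J0 (c : {ffun 'I_d -> 'I_(N.+1 + N.+1)}) :
    (0 <= \int[mu]_(x in tile r c) (`|f x - f (y c)| `^ p)%:E)%E.
  by apply: integral_ge0 => x _; rewrite lee_fin powR_ge0.
have G0 (c : {ffun 'I_d -> 'I_(N.+1 + N.+1)}) : (0 <= (tau * gauge (f (y c)) `^ p)%:E)%E.
  by rewrite lee_fin mulr_ge0 ?powR_ge0// ltW.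
have A0 (c : {ffun 'I_d -> 'I_(N.+1 + N.+1)}) : (0 <= A c)%E by exact: adde_ge0.
have sumA : (\sum_c A c <= eta%:E)%E.
  have mA : (m%:E * \sum_c A c <= m%:E * eta%:E)%E.
    rewrite ge0_sume_distrr//.
    rewrite (eq_bigr (fun c => mu (tile r c) * A c)%E); last first.
      by move=> c _; rewrite tE mE.
    apply: le_trans yP _.
    have cubem : (mu (cube r) <= (2 ^+ d * m)%:E)%E.
      by have := lebesgue_cube_le c0 r0; rewrite mE -EFinM natrX.
    apply: (@le_trans _ _ ((eta / (2 * 2 ^+ d))%:E * (2 ^+ d * m)%:E + (tau * M)%:E)%E).
      by apply: leeD2r; apply: lee_wpmul2l => //; rewrite lee_fin.
    rewrite -!EFinM -EFinD lee_fin.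
    have -> : eta / (2 * 2 ^+ d) * (2 ^+ d * m) = eta * m / 2.
      by field; rewrite expf_neq0.
    have -> : tau * M = eta * m / 2 * (M / (M + 1)).
      by rewrite /tau; field; rewrite gt_eqF.
    have -> : m * eta = eta * m / 2 + eta * m / 2 by field.
    rewrite lerD2l ger_pMr ?divr_gt0 ?mulr_gt0// ler_pdivrMr// mul1r.
    by rewrite lerDl.
  by rewrite lee_pmul2l// in mA; rewrite lte_fin.
exists (fun c => f (y c)); split; last first.
  by apply: le_trans sumA; apply: lee_sum => c _; exact: leeDl.
move=> c; split; first exact: fX.
have : (A c <= eta%:E)%E.
  apply: le_trans sumA; rewrite (bigD1 c)//=; apply: leeDl.
  by apply: sume_ge0 => c' _; exact: A0.
move/(le_trans (leeDr _ (J0 c))); rewrite lee_fin => gle.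
have {}gle : gauge (f (y c)) `^ p <= 2 * (M + 1) / m.
  rewrite -(ler_pM2l tau0); apply: le_trans gle _.
  rewrite le_eqVlt; apply/orP; left; apply/eqP.
  by rewrite /tau; field; rewrite !gt_eqF.
have pn0 : p != 0 by rewrite gt_eqF.
have -> : gauge (f (y c)) = (gauge (f (y c)) `^ p) `^ p^-1.
  by rewrite -powRrM mulfV// powRr1.
apply: ge0_ler_powR; rewrite ?nnegrE ?powR_ge0//; first by rewrite invr_ge0 ltW.
by apply: divr_ge0; [apply: mulr_ge0 => //|]; exact: ltW.
Qed.

End cone_sampling.

(** * From equicontinuity in Y to equicontinuity in B *)

Section equicontinuity.
Context {R : realType} {d : nat}.
Local Notation mu := (@lebesgueRd R d).

(** The interpolation inequality at the values f (x + h) and f x, raised to the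
    power p and integrated. *)
Lemma gauge_equicontinuous (V : lmodType R) (B Y : normedModType R)
    (iB : {linear B -> V}) (iY : {linear Y -> V}) (X : set B) (gauge : B -> R)
    (F : set (Rd R d -> B)) (p M eta : R) :
  compactly_gauged_cone X gauge -> no_separating_sequence iB iY ->
  0 < p -> F `<=` Lp_cone X gauge p ->
  (forall f, F f -> Lp_representatives iB iY p [set f] !=set0) ->
  0 <= M -> (forall f, F f -> (\int[mu]_x (gauge (f x) `^ p)%:E <= M%:E)%E) ->
  Lp_equicontinuous p (Lp_representatives iB iY p F) -> 0 < eta ->
  exists2 delta : R, 0 < delta & forall h, euclid h < delta ->
    forall f, F f ->
    (\int[mu]_x (`|f (translation h x) - f x| `^ p)%:E <= eta%:E)%E.
Proof.
move=> cone sep p0 FX FY M0 FM equi eta0.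
have pn0 : p != 0 by rewrite gt_eqF.
have root (a : R) : 0 < a -> (a `^ p^-1) `^ p = a.
  by move=> a0; rewrite -powRrM mulVf// powRr1// ltW.
have tp0 : 0 < 2 `^ p :> R by exact: powR_gt0.
(* e and om are chosen so that each of the two terms of the interpolation
   inequality, after p-th powers and integration, contributes at most eta / 2;
   the + 1 keeps K positive when M = 0. *)
pose K := 2 `^ p * (2 `^ p * (M + M)) + 1.
have K0 : 0 < K by rewrite ltr_wpDl// !mulr_ge0 ?powR_ge0 ?addr_ge0.
pose e := (eta / 2 / K) `^ p^-1.
have e0 : 0 < e by rewrite powR_gt0// !divr_gt0.
have ep : e `^ p = eta / 2 / K by rewrite root// !divr_gt0.
have [C C0 CP] := gauge_interpolation cone sep e0.
have ep0 : 0 < e `^ p by exact: powR_gt0.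
have Cp0 : 0 < C `^ p by exact: powR_gt0.
pose om := (eta / 2 / (2 `^ p * C `^ p)) `^ p^-1.
have om0 : 0 < om by rewrite powR_gt0// !divr_gt0// mulr_gt0.
have omp : om `^ p = eta / 2 / (2 `^ p * C `^ p).
  by rewrite root// !divr_gt0// mulr_gt0.
have [delta delta0 dP] := equi _ om0.
exists delta => // h hd f Ff.
have [fX bf mg _] := FX _ Ff.
have [y [[by_ yLp] [_ -> yf]]] := FY _ Ff.
have yF : Lp_representatives iB iY p F y by split => //; exists f.
have ydist := ltW (dP h hd y yF).
rewrite /Lp_dist /Lp_norm Lnorm_le ?(ltW om0)// in ydist.
have g0 x : 0 <= gauge (f x) by exact: gauge_ge0 cone _ (fX x).
pose G x : \bar R := (gauge (f x) `^ p)%:E.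
have mG : measurable_fun setT G.
  by apply/measurable_EFinP; exact: measurableT_comp (measurable_powR p) mg.
have G0 x : (0 <= G x)%E by rewrite lee_fin powR_ge0.
have mGh : measurable_fun setT (G \o translation h).
  exact: measurableT_comp mG (measurable_translate h).
have IGh : (\int[mu]_x (G \o translation h) x <= M%:E)%E.
  apply: le_trans (FM f Ff).
  have := @ge0_integral_translate R d h setT G measurableT mG (fun x _ => G0 x).
  by rewrite preimage_setT => ->.
pose W x : \bar R := (`|y (translation h x) - y x| `^ p)%:E.
have mW : measurable_fun setT W by exact: measurable_norm_translate_pow.
have W0 x : (0 <= W x)%E by rewrite lee_fin powR_ge0.
pose a := 2 `^ p * (e `^ p * 2 `^ p); pose b := 2 `^ p * C `^ p.
have a0 : 0 <= a by rewrite !mulr_ge0 ?powR_ge0.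
have b0 : 0 <= b by rewrite mulr_ge0 ?powR_ge0.
have mGG : measurable_fun setT (fun x => (G \o translation h) x + G x)%E.
  exact: (emeasurable_funD mGh mG).
have GG0 x : (0 <= (G \o translation h) x + G x)%E by apply: adde_ge0; exact: G0.
have maG : measurable_fun setT (fun x => a%:E * ((G \o translation h) x + G x))%E.
  exact: measurable_funeM.
have mbW : measurable_fun setT (fun x => b%:E * W x)%E by exact: measurable_funeM.
have aG0 x : (0 <= a%:E * ((G \o translation h) x + G x))%E.
  by apply: mule_ge0; [rewrite lee_fin|exact: GG0].
have bW0 x : (0 <= b%:E * W x)%E by apply: mule_ge0; [rewrite lee_fin|exact: W0].
pose I := (\int[mu]_x (a%:E * ((G \o translation h) x + G x) + b%:E * W x))%E.
apply: (@le_trans _ _ I).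
  apply: ae_ge0_le_integral.
  - exact: measurableT.
  - by move=> x _; rewrite lee_fin powR_ge0.
  - exact: measurable_norm_translate_pow.
  - by move=> x _; apply: adde_ge0; [exact: aG0|exact: bW0].
  - exact: (emeasurable_funD maG mbW).
  - have := ae_translate h yf; apply: filterS2 yf => x e1 e2 _.
    have hxy := CP _ _ (y (translation h x) - y x) (fX (translation h x)) (fX x).
    rewrite !linearB /= e1 e2 in hxy; have {hxy e1 e2} hxy := hxy erefl.
    rewrite /G /W /= lee_fin.
    apply: le_trans (ge0_ler_powR (ltW p0) _ _ hxy) _.
    + by rewrite nnegrE.
    + by rewrite nnegrE addr_ge0 ?mulr_ge0 ?addr_ge0 ?(ltW e0) ?(ltW C0).
    have eg0 : 0 <= e * (gauge (f (translation h x)) + gauge (f x)).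
      by rewrite mulr_ge0 ?addr_ge0// ltW.
    have Cw0 : 0 <= C * `|y (translation h x) - y x| by rewrite mulr_ge0// ltW.
    apply: le_trans (powR_add_le (ltW p0) eg0 Cw0) _.
    rewrite !powRM ?addr_ge0 ?(ltW e0) ?(ltW C0)//.
    rewrite mulrDr /a /b -!mulrA lerD2r ler_pM2l// ler_pM2l ?ep0//.
    exact: powR_add_le (ltW p0) _ _.
have -> : I = (a%:E * (\int[mu]_x (G \o translation h) x + \int[mu]_x G x) +
    b%:E * \int[mu]_x W x)%E.
  rewrite -(ge0_integralD mu measurableT (fun x _ => G0 (translation h x)) mGh
    (fun x _ => G0 x) mG).
  rewrite -(ge0_integralZl mu measurableT mGG (fun x _ => GG0 x)); last by rewrite lee_fin.
  rewrite -(ge0_integralZl mu measurableT mW (fun x _ => W0 x)); last by rewrite lee_fin.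
  exact: (ge0_integralD mu measurableT (fun x _ => aG0 x) maG (fun x _ => bW0 x) mbW).
apply: (@le_trans _ _ (a%:E * (M%:E + M%:E) + b%:E * (om `^ p)%:E)%E).
  apply: leeD; apply: lee_wpmul2l; rewrite ?lee_fin//.
  by apply: leeD; [exact: IGh|exact: FM].
rewrite lee_fin.
have -> : b * om `^ p = eta / 2.
  by rewrite omp /b; field; rewrite !gt_eqF.
have -> : a * (M + M) = eta / 2 * ((K - 1) / K).
  by rewrite /a ep /K; field; rewrite gt_eqF.
rewrite {3}(splitr eta) lerD2r ger_pMr ?divr_gt0// ler_pdivrMr// mul1r.
by rewrite lerBlDr lerDl.
Qed.

End equicontinuity.

(** * Total boundedness *)

Section total_boundedness.
Context {R : realType} {d : nat}.
Local Notation mu := (@lebesgueRd R d).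

Lemma integral_powR_add_le (p : R) (D : set (Rd R d)) (u v w : Rd R d -> R) :
  0 <= p -> measurable D -> measurable_fun setT u -> measurable_fun setT v ->
  measurable_fun setT w -> (forall x, 0 <= u x) -> (forall x, 0 <= v x) ->
  (forall x, 0 <= w x) -> (forall x, u x <= v x + w x) ->
  (\int[mu]_(x in D) (u x `^ p)%:E <= (2 `^ p)%:E *
    (\int[mu]_(x in D) (v x `^ p)%:E + \int[mu]_(x in D) (w x `^ p)%:E))%E.
Proof.
move=> p0 mD mu_ mv mw u0 v0 w0 uvw.
have mP (t : Rd R d -> R) : measurable_fun setT t ->
    measurable_fun D (fun x => (t x `^ p)%:E).
  move=> mt; apply: measurable_funTS; apply/measurable_EFinP.
  exact: measurableT_comp (measurable_powR p) mt.
have P0 (t : Rd R d -> R) x : (0 <= (t x `^ p)%:E)%E by rewrite lee_fin powR_ge0.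
have mS : measurable_fun D (fun x => (v x `^ p)%:E + (w x `^ p)%:E)%E.
  exact: (emeasurable_funD (mP _ mv) (mP _ mw)).
have S0 x : (0 <= (v x `^ p)%:E + (w x `^ p)%:E)%E by apply: adde_ge0; exact: P0.
have tp0 : (0 <= (2 `^ p)%:E)%E by rewrite lee_fin powR_ge0.
rewrite -(ge0_integralD mu mD (fun x _ => P0 v x) (mP _ mv) (fun x _ => P0 w x) (mP _ mw)).
rewrite -(ge0_integralZl mu mD mS (fun x _ => S0 x) tp0).
apply: ge0_le_integral.
- exact: mD.
- by move=> x _; exact: P0.
- exact: mP.
- exact: (measurable_funeM _ mS).
- move=> x _; rewrite lee_fin.
  apply: le_trans (powR_add_le p0 (v0 x) (w0 x)).
  by apply: ge0_ler_powR; rewrite ?nnegrE// addr_ge0.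
Qed.

Variables (B : normedModType R) (X : set B) (gauge : B -> R).
Hypothesis cone : compactly_gauged_cone X gauge.

Lemma Lp_coneW (p : R) (f : Rd R d -> B) : 0 < p ->
  Lp_cone X gauge p f -> Lp B p f.
Proof.
move=> p0 [fX bf mg goo]; split => //.
have [C C0 CP] := le_norm_gauge cone.
have g0 x : 0 <= gauge (f x) by exact: gauge_ge0 cone _ (fX x).
have mG : measurable_fun setT (fun x => (gauge (f x) `^ p)%:E).
  by apply/measurable_EFinP; exact: measurableT_comp (measurable_powR p) mg.
have G0 x : (0 <= (gauge (f x) `^ p)%:E)%E by rewrite lee_fin powR_ge0.
pose M := fine (\int[mu]_x (gauge (f x) `^ p)%:E)%E.
have ME : (\int[mu]_x (gauge (f x) `^ p)%:E = M%:E)%E.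
  rewrite fineK// ge0_fin_numE//.
  by apply: integral_ge0 => x _; exact: G0.
have M0 : 0 <= M by apply: fine_ge0; apply: integral_ge0 => x _; exact: G0.
have CM0 : 0 <= C `^ p * M by rewrite mulr_ge0 ?powR_ge0.
apply: (@le_lt_trans _ _ ((C `^ p * M) `^ p^-1)%:E); last exact: ltry.
rewrite /Lp_norm Lnorm_le ?powR_ge0// -powRrM mulVf ?gt_eqF// powRr1// EFinM -ME.
have Cp0 : (0 <= (C `^ p)%:E)%E by rewrite lee_fin powR_ge0.
rewrite -(ge0_integralZl mu measurableT mG (fun x _ => G0 x) Cp0).
apply: ge0_le_integral.
- exact: measurableT.
- by move=> x _; rewrite lee_fin powR_ge0.
- exact: measurable_norm_pow.
- exact: (measurable_funeM _ mG).
- move=> x _; rewrite lee_fin -powRM ?(ltW C0)//.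
  apply: ge0_ler_powR; rewrite ?nnegrE ?(ltW p0)//.
    by rewrite mulr_ge0 ?(ltW C0).
  exact: CP (fX x).
Qed.

(** A code b assigns to each tile a point of a finite net of the gauge ball of
    radius L.  The functions f that are close, on the tiles, to the step function
    of b form one set of the cover, and sampling shows that every f in F has a
    code. *)
Lemma cone_totally_bounded (F : set (Rd R d -> B)) (p M : R) :
  0 < p -> 0 <= M -> F `<=` Lp_cone X gauge p ->
  (forall f, F f -> (\int[mu]_x (gauge (f x) `^ p)%:E <= M%:E)%E) ->
  Lp_equivanishing p F ->
  (forall eta : R, 0 < eta -> exists2 delta : R, 0 < delta &
    forall h, euclid h < delta -> forall f, F f ->
    (\int[mu]_x (`|f (translation h x) - f x| `^ p)%:E <= eta%:E)%E) ->
  totally_bounded (Lp_dist p) (Lp B p) F.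
Proof.
move=> p0 M0 FX FM Fvan Fequi e e0.
have pn0 : p != 0 by rewrite gt_eqF.
have tp0 : 0 < 2 `^ p :> R by exact: powR_gt0.
have e20 : 0 < e / 2 by rewrite divr_gt0.
(* Two functions with the same code differ, in integrated p-th power, by at most
   2^p (eta + eta) on the tiles and by as much outside, (e / 2)^p in total. *)
pose eta := (e / 2) `^ p / (4 * 2 `^ p).
have eta0 : 0 < eta by rewrite divr_gt0 ?powR_gt0// mulr_gt0.
pose eta1 := eta / (2 * 2 `^ p).
have eta10 : 0 < eta1 by rewrite divr_gt0// mulr_gt0.
have [r0 r0P] := Fvan _ eta0.
pose R0 := Num.max 0 r0.
have [|delta delta0 dP] := Fequi (eta1 / (2 * 2 ^+ d)).
  by rewrite divr_gt0// mulr_gt0// exprn_gt0.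
pose r := delta / d.+1%:R.
have rpos : 0 < r by rewrite divr_gt0// ltr0n.
have rdelta (h : 'rV[R]_d) : cube r h -> euclid h < delta.
  have rd : r * d.+1%:R = delta by rewrite /r divfK// pnatr_eq0.
  by move=> hr; rewrite -rd; exact: cube_euclid_lt.
pose N := Num.truncn (R0 / r).
have R0N : R0 < r * N.+1%:R.
  have R00 : 0 <= R0 / r by rewrite divr_ge0 ?(ltW rpos)// le_max lexx.
  by have /andP[_] := truncn_itv R00; rewrite ltr_pdivrMr// mulrC.
have [L L0 LP] := @cone_sampling R d B X gauge cone p r M eta1 N p0 rpos M0 eta10.
pose I := {ffun 'I_d -> 'I_(N.+1 + N.+1)}.
pose m := fine (mu (tile r ([ffun => ord0] : I))).
have mE (c : I) : mu (tile r c) = m%:E.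
  rewrite fineK; first exact: lebesgue_tile.
  by rewrite ge0_fin_numE ?measure_ge0// tileE; exact: lebesgue_box_lty.
have m0 : 0 <= m by apply: fine_ge0; exact: measure_ge0.
(* The net is so fine that rounding costs at most eta1 in total over all
   tiles. *)
pose K := #|I|%:R * m + 1 : R.
have K0 : 0 < K by rewrite ltr_wpDl// mulr_ge0.
pose e1 := (eta1 / K) `^ p^-1.
have e10 : 0 < e1 by rewrite powR_gt0// divr_gt0.
have e1p : e1 `^ p = eta1 / K by rewrite -powRrM mulVf// powRr1// divr_ge0// ltW.
have [s sP] := gauge_ball_net cone L0 e10.
pose T := {ffun I -> seq_sub s}.
pose J (f : Rd R d -> B) (b : T) :=
  (\sum_(c : I) \int[mu]_(x in tile r c) (`|f x - ssval (b c)| `^ p)%:E)%E.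
exists #|T|, (fun i => [set f | F f /\ (J f (enum_val i) <= eta%:E)%E]).
split; last first.
  move=> f Ff; have [fX bf mg _] := FX _ Ff.
  have [|v [vL vJ]] := LP f (FX _ Ff) (FM _ Ff).
    by move=> h /rdelta hd; exact: dP.
  have near c : exists b : seq_sub s, `|v c - ssval b| < e1.
    have [Xv gv] := vL c; have [b bs vb] := sP _ Xv gv.
    by exists (SeqSub bs).
  have [b bP] := choice near.
  exists (enum_rank ([ffun c => b c] : T)) => //=; split => //.
  rewrite enum_rankK /J.
  apply: (@le_trans _ _ (\sum_(c : I) (2 `^ p)%:E *
      (\int[mu]_(x in tile r c) (`|f x - v c| `^ p)%:E + (e1 `^ p * m)%:E))%E).
    apply: lee_sum => c _; rewrite ffunE.
    apply: le_trans (@integral_powR_add_le p (tile r c) _ (fun x => `|f x - v c|)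
      (fun=> `|v c - ssval (b c)|) (ltW p0) (measurable_tile r c)
      (measurable_norm_sub_cst (ssval (b c)) bf) (measurable_norm_sub_cst (v c) bf)
      (measurable_cst _) (fun x => normr_ge0 _) (fun x => normr_ge0 _)
      (fun x => normr_ge0 _) _) _.
      by move=> x; rewrite -[f x - _](subrKA (v c)) ler_normD.
    apply: lee_wpmul2l; first by rewrite lee_fin ltW.
    apply: leeD2l; rewrite (@integral_cst _ _ _ mu _ (measurable_tile r c)).
    suff h : ((`|v c - ssval (b c)| `^ p)%:E * mu (tile r c) <= (e1 `^ p * m)%:E)%E.
      exact: h.
    rewrite mE -EFinM lee_fin ler_wpM2r//.
    by apply: ge0_ler_powR; rewrite ?nnegrE ?(ltW p0) ?(ltW e10) ?(ltW (bP c)).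
  rewrite -ge0_sume_distrr; last first.
    move=> c _; apply: adde_ge0; last by rewrite lee_fin mulr_ge0// powR_ge0.
    by apply: integral_ge0 => x _; rewrite lee_fin powR_ge0.
  rewrite big_split /=.
  apply: (@le_trans _ _ ((2 `^ p)%:E * (eta1%:E + eta1%:E))%E).
    apply: lee_wpmul2l; first by rewrite lee_fin ltW.
    apply: leeD; first exact: vJ.
    rewrite sumEFin lee_fin sumr_const e1p.
    have -> : eta1 / K * m *+ #|I| = eta1 * ((K - 1) / K).
      by rewrite -mulr_natr /K; field; rewrite gt_eqF.
    by rewrite ger_pMr// ler_pdivrMr// mul1r lerBlDr lerDl.
  rewrite lee_fin le_eqVlt; apply/orP; left; apply/eqP.
  by rewrite /eta1; field; rewrite gt_eqF.
move=> i; split => [f [/FX fX _]|]; first exact: Lp_coneW.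
apply: (@le_lt_trans _ _ (e / 2)%:E); last first.
  by rewrite lte_fin ltr_pdivrMr// ltr_pMr// ltr1n.
apply: ge_ereal_sup => _ [[f g] [/= [Ff fJ] [Fg gJ]] <-].
have [fX bf _ _] := FX _ Ff; have [gX bg _ _] := FX _ Fg.
rewrite /Lp_dist /Lp_norm Lnorm_le ?(ltW e20)//.
have mfg := measurable_norm_sub bf bg.
have mfgp : measurable_fun setT (fun x => (`|f x - g x| `^ p)%:E).
  exact: measurable_norm_sub_pow.
have fgp0 x : (0 <= (`|f x - g x| `^ p)%:E)%E by rewrite lee_fin powR_ge0.
have fg_split := @integral_le_tiles R d r N.+1 _ rpos mfgp fgp0.
apply: le_trans fg_split _.
set W : set (Rd R d) := ~` _.
have mW : measurable W by apply: measurableC; exact: measurable_cube.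
have mE0 : measurable ([set x | (R0 < euclid x)%R] : set (Rd R d)).
  rewrite -[X in measurable X]setTI.
  have -> : [set x | (R0 < euclid x)%R] = (euclid : Rd R d -> R) @^-1` `]R0, +oo[%classic.
    by apply/seteqP; split => x /=; rewrite in_itv/= andbT.
  exact: measurable_euclid.
have tail (u : Rd R d -> B) : F u -> bochner_measurable u ->
    (\int[mu]_(x in W) (`|u x| `^ p)%:E <= eta%:E)%E.
  move=> Fu bu; have R0r : r0 <= R0 by rewrite le_max lexx orbT.
  apply: le_trans (ltW (r0P _ R0r u Fu)).
  apply: ge0_subset_integral.
  - exact: mW.
  - exact: mE0.
  - exact: measurable_norm_pow.
  - by move=> x _; rewrite lee_fin powR_ge0.
  - move=> x Wx /=; rewrite ltNge; apply/negP => xR0; apply: Wx.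
    exact: euclid_lt_cube (le_lt_trans xR0 R0N).
have norm_m (u : Rd R d -> B) :
    bochner_measurable u -> measurable_fun setT (fun x => `|u x|).
  move=> /(measurable_norm_sub_cst 0); congr measurable_fun.
  by apply/funext => x; rewrite subr0.
apply: (@le_trans _ _ ((2 `^ p)%:E * (eta%:E + eta%:E) +
    (2 `^ p)%:E * (eta%:E + eta%:E))%E).
  apply: leeD.
    apply: (@le_trans _ _ ((2 `^ p)%:E * (J f (enum_val i) + J g (enum_val i)))%E); last first.
      apply: lee_wpmul2l; first by rewrite lee_fin ltW.
      exact: (leeD fJ gJ).
    rewrite /J -big_split /= ge0_sume_distrr; last first.
      by move=> c _; apply: adde_ge0; apply: integral_ge0 => x _; rewrite lee_fin powR_ge0.
    apply: lee_sum => c _.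
    apply: (@integral_powR_add_le p (tile r c) (fun x => `|f x - g x|)
      (fun x => `|f x - ssval ((enum_val i : T) c)|)
      (fun x => `|g x - ssval ((enum_val i : T) c)|) (ltW p0) (measurable_tile r c)
      mfg (measurable_norm_sub_cst _ bf) (measurable_norm_sub_cst _ bg)) => // x.
    rewrite (distrC (g x)) -[f x - g x](subrKA (ssval ((enum_val i : T) c))).
    exact: ler_normD.
  apply: le_trans (@integral_powR_add_le p W (fun x => `|f x - g x|)
      (fun x => `|f x|) (fun x => `|g x|) (ltW p0) mW
      mfg (norm_m _ bf) (norm_m _ bg) _ _ _ _) _ => // [x|].
    exact: ler_normB.
  apply: lee_wpmul2l; first by rewrite lee_fin ltW.
  by apply: leeD; [exact: tail bf|exact: tail bg].
rewrite lee_fin le_eqVlt; apply/orP; left; apply/eqP.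
by rewrite /eta; field; rewrite gt_eqF.
Qed.

End total_boundedness.

Theorem theorem2p13 (R : realType) (d : nat) (p : R) (hp : 1 <= p)
  (V : lmodType R) (B Y : completeNormedModType R)
  (iB : {linear B -> V}) (iB_inj : injective iB)
  (iY : {linear Y -> V}) (iY_inj : injective iY)
  (X : set B) (gauge : B -> R) (hX : compactly_gauged_cone X gauge)
  (hBY : no_separating_sequence iB iY)
  (F : set (Rd R d -> B))
  (FX : F `<=` Lp_cone X gauge p)
  (FY : forall f, F f -> Lp_representatives iB iY p [set f] !=set0)
  (F_bounded : (ereal_sup [set Lp_gauge gauge p f | f in F] < +oo)%E)
  (F_equivanishing : Lp_equivanishing p F)
  (F_equicontinuous : Lp_equicontinuous p (Lp_representatives iB iY p F)) :
  totally_bounded (Lp_dist p) (Lp B p) F.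
Proof.
have p0 : 0 < p by exact: lt_le_trans hp.
have g0 f x : F f -> 0 <= gauge (f x).
  by move=> /FX[fX _ _ _]; exact: (gauge_ge0 hX (fX x)).
have [c c0 cP] : exists2 c : R, 0 <= c &
    (ereal_sup [set Lp_gauge gauge p f | f in F] <= c%:E)%E.
  move: F_bounded; case: ereal_sup => [s _|//|_].
    by exists (Num.max 0 s); rewrite ?lee_fin le_max lexx ?orbT.
  by exists 0; rewrite ?leNye.
have FM f : F f ->
    (\int[@lebesgueRd R d]_x (gauge (f x) `^ p)%:E <= (c `^ p)%:E)%E.
  move=> Ff; have <- := Lnorm_le p0 c0 (fun x => g0 f x Ff).
  by apply: le_trans cP; apply: ereal_sup_ubound; exists f.
apply: (cone_totally_bounded hX p0 (powR_ge0 c p) FX FM F_equivanishing) => eta.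
exact: gauge_equicontinuous hX hBY p0 FX FY (powR_ge0 c p) FM F_equicontinuous.
Qed.
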